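(* Let $(g,f,\Phi)$ be admissible saddle-point data and let $\{(x_n,y_n)\}_{n\ge 0}$ be generated by the algorithm NPDAL-n (with any admissible choice of its parameters and starting points). Then $\{(x_n,y_n)\}$ converges to a solution of the saddle-point problem $\min_{x\in\mathbb{R}^q}\max_{y\in\mathbb{R}^p} g(x)+\Phi(x,y)-f^*(y)$, i.e. there is $(x^\star,y^\star)\in\Omega$ with $x_n\to x^\star$ and $y_n\to y^\star$.
   Context: **Problem.** $g:\mathbb{R}^q\to(-\infty,+\infty]$ and $f:\mathbb{R}^p\to(-\infty,+\infty]$ are proper, closed, convex; $f^*$ is the Legendre–Fenchel conjugate of $f$; $\Phi:\mathrm{dom}(g)\times\mathrm{dom}(f^* )\to\mathbb{R}$. Put $\mathcal{L}(x,y)=g(x)+\Phi(x,y)-f^*(y)$. A saddle point is a pair $(x^*,y^* )\in\mathrm{dom}(g)\times\mathrm{dom}(f^* )$ with $\mathcal{L}(x^*,y)\le\mathcal{L}(x^*,y^* )\le\mathcal{L}(x,y^* )$ for all $(x,y)\in\mathrm{dom}(g)\times\mathrm{dom}(f^* )$; $\Omega$ is the set of saddle points (equivalently, pairs with $-\nabla_x\Phi(x^*,y^* )\in\partial g(x^* )$ and $\nabla_y\Phi(x^*,y^* )\in\partial f^*(y^* )$). **Admissible data** means: (1) $\Omega\ne\emptyset$ and $\mathcal{L}(x^*,y^* )$ is finite; (2) $\Phi$ is continuous; for each fixed $y\in\mathrm{dom}(f^* )$ it is convex and differentiable in $x$ over $\mathrm{dom}(g)$, and for each fixed $x\in\mathrm{dom}(g)$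 it is concave and differentiable in $y$ over $\mathrm{dom}(f^* )$; (3) for any bounded $\mathcal{X}\subset\mathbb{R}^q$, $\mathcal{Y}\subset\mathbb{R}^p$ there are $L_{xx}\ge0$, $L_{yy}\ge0$, $L_{xy}>0$ such that for all $x,\tilde x\in\mathcal{X}\cap\mathrm{dom}(g)$, $y,\tilde y\in\mathcal{Y}\cap\mathrm{dom}(f^* )$: $\|\nabla_y\Phi(x,y)-\nabla_y\Phi(x,\tilde y)\|\le L_{yy}\|y-\tilde y\|$ and $\|\nabla_x\Phi(x,y)-\nabla_x\Phi(\tilde x,\tilde y)\|\le L_{xx}\|x-\tilde x\|+L_{xy}\|y-\tilde y\|$. $\mathrm{Prox}_{\lambda\phi}(x)=\operatorname{argmin}_u\{\phi(u)+\frac1{2\lambda}\|u-x\|^2\}$. **Algorithm NPDAL-n.** Parameters: $\psi\in(1,1+\sqrt3)$, $a\in(0,1)$, $b\in[0,1)$, $\xi>0$, $1<\varphi<\psi$, $0<\xi_1<1/\varphi$ such that $\omega_1:=(1-a)\bigl(2\psi-\xi-\frac{\psi^3\varphi}{1+\psi}\bigr)-\frac a{\xi_1}>0$; $\tau_{\max}>0$, $\nu\in(0,1)$, $\mu\in(0,1)$, $\eta\in[0,1)$, integer $M\ge1$, $\beta>0$, $\tau_0\in(0,\tau_{\max}]$, $\delta_0>0$. Start: $x_0\in\mathrm{dom}(g)$, $y_0\in\mathrm{dom}(f^* )$, $z_0=x_0$, $\bar z_0=y_0$. For $n=1,2,\dots$: 1. $z_n=\frac{\psi-1}\psi x_{n-1}+\frac1\psi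 z_{n-1}$, $x_n^{md}=ax_{n-1}+(1-a)z_n$, $x_n=\mathrm{Prox}_{\tau_{n-1}g}(x_n^{md}-\tau_{n-1}\nabla_x\Phi(x_{n-1},y_{n-1}))$. 2. $\bar z_n=(1-b)y_{n-1}+b\bar z_{n-1}$, $y_n^{md}=by_{n-1}+(1-b)\bar z_n$. 3. (Linesearch) With $\tau=\min\{\varphi\tau_{n-1},\tau_{\max}\}$, let $\tau_n=\tau\mu^i$ with $i$ the first of $0,1,2,\dots$ for which, with $y_n=\mathrm{Prox}_{\beta\tau_nf^*}(y_n^{md}+\beta\tau_n\nabla_y\Phi(x_n,y_{n-1}))$, $$\frac{\tau_n\tau_{n-1}}{(1-a)\xi}\|\theta_n\|^2+2\tau_n\Phi_n^y\le\nu r_n+(1-\nu)c_n,$$ where $\theta_n=\nabla_x\Phi(x_n,y_n)-\nabla_x\Phi(x_{n-1},y_{n-1})$, $\Phi_n^y=\Phi(x_n,y_{n-1})+\langle\nabla_y\Phi(x_n,y_{n-1}),y_n-y_{n-1}\rangle-\Phi(x_n,y_n)$, $r_n=\omega_1\delta_{n-1}\|x_n-x_{n-1}\|^2+\frac b\beta\|y_n-y_{n-1}\|^2+\frac1\beta(1-b)(1+b)\|y_n-\bar z_n\|^2$, $c_n=\frac{\eta}{|I_n|}\sum_{i\in I_n}r_i$, $I_n=\{n-1,n-2,\dots,\max\{n-M,1\}\}$ for $n\ge2$, and $c_1=0$. 4. $\delta_n=\tau_n/\tau_{n-1}$. *)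

(* Defs.v *)
From mathcomp Require Import all_boot all_order all_algebra.
From mathcomp Require Import all_classical all_reals all_analysis.
Set Implicit Arguments.
Unset Strict Implicit.
Unset Printing Implicit Defensive.
Import Order.TTheory GRing.Theory Num.Theory.
Import numFieldNormedType.Exports.
Local Open Scope classical_set_scope.
Local Open Scope ring_scope.

Section ConvexAnalysis.
Context {R : realType} {n : nat}.
Implicit Types (u v x : 'rV[R]_n) (phi : 'rV[R]_n -> \bar R).

Definition dot u v : R := \sum_(i < n) u 0 i * v 0 i.

(* The library norm `|u| on 'rV[R]_n is the sup norm, hence this one; the
   topology and the bounded sets are the same for both. *)
Definition enorm u : R := Num.sqrt (dot u u).

Definition dom phi : set 'rV[R]_n := [set x | (phi x < +oo)%E].

Definition proper_fun phi : Prop := (forall x, (-oo < phi x)%E) /\ dom phi !=set0.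

Definition closed_fun phi : Prop :=
  closed [set w : 'rV[R]_n * R | (phi w.1 <= w.2%:E)%E].

(* As 0 * +oo = 0, the cases t = 0 and t = 1 are trivially satisfied. *)
Definition convex_efun phi : Prop :=
  forall x u (t : R), 0 <= t <= 1 ->
    (phi (t *: x + (1 - t) *: u)%R <= t%:E * phi x + (1 - t)%:E * phi u)%E.

Definition conjugate phi : 'rV[R]_n -> \bar R :=
  fun v => ereal_sup [set ((dot x v)%:E - phi x)%E | x in [set: 'rV[R]_n]].

Definition argmin phi : set 'rV[R]_n := [set u | forall v, (phi u <= phi v)%E].

(* The set of minimizers; it is a singleton when phi is proper, closed and
   convex and lam > 0. *)
Definition prox (lam : R) phi x : set 'rV[R]_n :=
  argmin (fun u => (phi u + ((2 * lam)^-1 * enorm (u - x) ^+ 2)%:E)%E).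

(* v is a gradient at x of the function h defined on A only: the first order
   expansion is required along points of A. For x interior to A this is the
   Frechet gradient. *)
Definition is_gradient_within (A : set 'rV[R]_n) (h : 'rV[R]_n -> R) x v : Prop :=
  forall e : R, 0 < e -> \forall u \near within A (nbhs x),
    `|h u - h x - dot v (u - x)| <= e * enorm (u - x).

End ConvexAnalysis.

(* Phi, gradx and grady are total, but only their values on
   dom g x dom f^* are ever constrained or used. When dom g or dom f^* has
   empty interior the partial gradients of Phi need not be unique, so they are
   part of the data. *)
Record saddle_data (R : realType) (q p : nat) := SaddleData {
  sd_g : 'rV[R]_q -> \bar R;
  sd_f : 'rV[R]_p -> \bar R;
  sd_Phi : 'rV[R]_q -> 'rV[R]_p -> R;
  sd_gradx : 'rV[R]_q -> 'rV[R]_p -> 'rV[R]_q;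
  sd_grady : 'rV[R]_q -> 'rV[R]_p -> 'rV[R]_p }.

Section SaddleProblem.
Context {R : realType} {q p : nat} (D : saddle_data R q p).
Local Notation g := (sd_g D).
Local Notation f := (sd_f D).
Local Notation Phi := (sd_Phi D).
Local Notation gradx := (sd_gradx D).
Local Notation grady := (sd_grady D).
Local Notation fs := (conjugate f).

Definition lagrangian (x : 'rV[R]_q) (y : 'rV[R]_p) : \bar R :=
  (g x + (Phi x y)%:E - fs y)%E.

Definition saddle_points : set ('rV[R]_q * 'rV[R]_p) :=
  [set w | [/\ dom g w.1, dom fs w.2 &
    forall x y, dom g x -> dom fs y ->
      (lagrangian w.1 y <= lagrangian w.1 w.2)%E /\
      (lagrangian w.1 w.2 <= lagrangian x w.2)%E]].

Record admissible_data : Prop := AdmissibleData {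
  adm_g : [/\ proper_fun g, closed_fun g & convex_efun g];
  adm_f : [/\ proper_fun f, closed_fun f & convex_efun f];
  adm_saddle : exists2 w, saddle_points w & lagrangian w.1 w.2 \is a fin_num;
  adm_continuous :
    {within dom g `*` dom fs, continuous (fun w => Phi w.1 w.2)};
  adm_convex : forall y, dom fs y ->
    convex_function (dom g) (fun x => Phi x y);
  adm_gradx : forall x y, dom g x -> dom fs y ->
    is_gradient_within (dom g) (fun u => Phi u y) x (gradx x y);
  adm_concave : forall x, dom g x ->
    convex_function (dom fs) (fun y => - Phi x y);
  adm_grady : forall x y, dom g x -> dom fs y ->
    is_gradient_within (dom fs) (fun v => Phi x v) y (grady x y);
  adm_lipschitz : forall (X : set 'rV[R]_q) (Y : set 'rV[R]_p),
    bounded_set X -> bounded_set Y ->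
    exists Lxx Lyy Lxy : R, [/\ 0 <= Lxx, 0 <= Lyy, 0 < Lxy &
      forall x x' y y', (X `&` dom g) x -> (X `&` dom g) x' ->
        (Y `&` dom fs) y -> (Y `&` dom fs) y' ->
        enorm (grady x y - grady x y') <= Lyy * enorm (y - y') /\
        enorm (gradx x y - gradx x' y')
          <= Lxx * enorm (x - x') + Lxy * enorm (y - y')] }.

End SaddleProblem.

(* npsi and nphi are the scalars psi > phi; the function Phi is sd_Phi. *)
Record npdal_params (R : realType) := NpdalParams {
  npsi : R; na : R; nb : R; nxi : R; nphi : R; nxi1 : R;
  ntaumax : R; nnu : R; nmu : R; neta : R; nM : nat; nbeta : R;
  ntau0 : R; ndelta0 : R }.

Definition omega1 (R : realType) (P : npdal_params R) : R :=
  (1 - na P) * (2 * npsi P - nxi P - npsi P ^+ 3 * nphi P / (1 + npsi P))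
  - na P / nxi1 P.

Record admissible_params (R : realType) (P : npdal_params R) : Prop :=
  AdmissibleParams {
  ap_psi : 1 < npsi P < 1 + Num.sqrt 3;
  ap_a : 0 < na P < 1;
  ap_b : 0 <= nb P < 1;
  ap_xi : 0 < nxi P;
  ap_phi : 1 < nphi P < npsi P;
  ap_xi1 : 0 < nxi1 P < (nphi P)^-1;
  ap_omega1 : 0 < omega1 P;
  ap_taumax : 0 < ntaumax P;
  ap_nu : 0 < nnu P < 1;
  ap_mu : 0 < nmu P < 1;
  ap_eta : 0 <= neta P < 1;
  ap_M : (1 <= nM P)%N;
  ap_beta : 0 < nbeta P;
  ap_tau0 : 0 < ntau0 P <= ntaumax P;
  ap_delta0 : 0 < ndelta0 P }.

Record iterates (R : realType) (q p : nat) := Iterates {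
  it_x : nat -> 'rV[R]_q;
  it_z : nat -> 'rV[R]_q;
  it_y : nat -> 'rV[R]_p;
  it_zb : nat -> 'rV[R]_p;
  it_tau : nat -> R;
  it_delta : nat -> R }.

Section Algorithm.
Context {R : realType} {q p : nat}.
Variables (D : saddle_data R q p) (P : npdal_params R) (S : iterates R q p).
Local Notation g := (sd_g D).
Local Notation fs := (conjugate (sd_f D)).
Local Notation Phi := (sd_Phi D).
Local Notation gradx := (sd_gradx D).
Local Notation grady := (sd_grady D).
Local Notation x := (it_x S).
Local Notation z := (it_z S).
Local Notation y := (it_y S).
Local Notation zb := (it_zb S).
Local Notation tau := (it_tau S).
Local Notation delta := (it_delta S).
Local Notation psi := (npsi P).
Local Notation a := (na P).
Local Notation b := (nb P).
Local Notation beta := (nbeta P).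

Implicit Types (n : nat) (t : R) (v : 'rV[R]_p).

(* In what follows n >= 1, t is a trial value of tau_n and v a trial value
   of y_n. *)

Definition x_md n : 'rV[R]_q := a *: x n.-1 + (1 - a) *: z n.

Definition y_md n : 'rV[R]_p := b *: y n.-1 + (1 - b) *: zb n.

Definition y_trial n t : set 'rV[R]_p :=
  prox (beta * t) fs (y_md n + (beta * t) *: grady (x n) (y n.-1)).

Definition ls_theta n v : 'rV[R]_q :=
  gradx (x n) v - gradx (x n.-1) (y n.-1).

Definition ls_Phi n v : R :=
  Phi (x n) (y n.-1) + dot (grady (x n) (y n.-1)) (v - y n.-1) - Phi (x n) v.

Definition ls_r n v : R :=
  omega1 P * delta n.-1 * enorm (x n - x n.-1) ^+ 2
  + b / beta * enorm (v - y n.-1) ^+ 2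
  + beta^-1 * (1 - b) * (1 + b) * enorm (v - zb n) ^+ 2.

(* I_n is the integer interval [maxn (n - M) 1, n - 1]. *)
Definition ls_c n : R :=
  let m := maxn (n - nM P) 1 in
  if (n <= 1)%N then 0
  else neta P / (n - m)%N%:R * \sum_(m <= i < n) ls_r i (y i).

Definition ls_accept n t v : bool :=
  t * tau n.-1 / ((1 - a) * nxi P) * enorm (ls_theta n v) ^+ 2
    + 2 * t * ls_Phi n v
  <= nnu P * ls_r n v + (1 - nnu P) * ls_c n.

Definition tau_start n : R := Num.min (nphi P * tau n.-1) (ntaumax P).

Record npdal_generated : Prop := NpdalGenerated {
  gen_x0 : dom g (x 0%N);
  gen_y0 : dom fs (y 0%N);
  gen_z0 : z 0%N = x 0%N;
  gen_zb0 : zb 0%N = y 0%N;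
  gen_tau0 : tau 0%N = ntau0 P;
  gen_delta0 : delta 0%N = ndelta0 P;
  gen_z : forall n, (1 <= n)%N ->
    z n = ((psi - 1) / psi) *: x n.-1 + psi^-1 *: z n.-1;
  gen_x : forall n, (1 <= n)%N ->
    prox (tau n.-1) g (x_md n - tau n.-1 *: gradx (x n.-1) (y n.-1)) (x n);
  gen_zb : forall n, (1 <= n)%N ->
    zb n = (1 - b) *: y n.-1 + b *: zb n.-1;
  gen_linesearch : forall n, (1 <= n)%N ->
    exists i : nat,
      [/\ tau n = tau_start n * nmu P ^+ i,
          y_trial n (tau n) (y n),
          ls_accept n (tau n) (y n) &
          forall j v, (j < i)%N -> y_trial n (tau_start n * nmu P ^+ j) v ->
            ~~ ls_accept n (tau_start n * nmu P ^+ j) v];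
  gen_delta : forall n, (1 <= n)%N -> delta n = tau n / tau n.-1 }.

End Algorithm.

(* Main.v *)
(** The prox inequalities for x_n, x_(n+1) and y_n give, for every saddle point
    (u, v), a descent inequality
      F_(n+1) + 2 tau_n gap_n + k |x_n - x_(n-1)|^2 + (1 - nu) r_n
        <= F_n + (1 - nu) c_n,
    where F_n >= 0 is a sum of weighted squared distances to (u, v) and gap_n >= 0.
    As c_n is eta times the average of the last M values of r, adding to F_n a
    weighted sum of these values gives a nonincreasing potential; hence r_n and
    the successive differences vanish and the iterates are bounded.

    The steps tau_n are bounded below: a rejected trial point at step tau_n / mu is
    at distance at most |y_n - y_n^md| / mu from y_n^md, because
    |prox_s(m) - m| / s is nonincreasing in s.  So the trial points stay bounded
    although grad_y Phi need not be bounded in x, and on a bounded set every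
    small enough step is accepted.

    Let (x, y) be a cluster point of the iterates.  First g(x_n) is bounded, as
    grad_x Phi is bounded along the iterates, so x is in dom g; then convexity in
    x bounds Phi(x_n, y_n) above, so y is in dom f^*; then the prox inequalities
    pass to the limit by the continuity of Phi, and (x, y) is a saddle point.  The
    potential relative to (x, y) is nonincreasing and small along a subsequence,
    so it tends to 0. *)

Require Import Defs.
From mathcomp Require Import all_boot all_order all_algebra.
From mathcomp Require Import all_classical all_reals all_analysis.
From mathcomp Require Import ring lra.
Import Order.TTheory GRing.Theory Num.Theory.
Import numFieldNormedType.Exports.
Local Open Scope classical_set_scope.
Local Open Scope ring_scope.

(** * The Euclidean norm *)

Section EuclideanSpace.
Context {R : realType} {n : nat}.
Implicit Types (u v w : 'rV[R]_n) (t : R).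

Lemma dotC u v : dot u v = dot v u.
Proof. by apply: eq_bigr => i _; rewrite mulrC. Qed.

Lemma dotDl u v w : dot (u + v) w = dot u w + dot v w.
Proof. by rewrite -big_split; apply: eq_bigr => i _; rewrite mxE mulrDl. Qed.

Lemma dotZl t u v : dot (t *: u) v = t * dot u v.
Proof. by rewrite mulr_sumr; apply: eq_bigr => i _; rewrite mxE mulrA. Qed.

Lemma dotNl u v : dot (- u) v = - dot u v.
Proof. by rewrite -scaleN1r dotZl mulN1r. Qed.

Lemma dotDr u v w : dot u (v + w) = dot u v + dot u w.
Proof. by rewrite dotC dotDl !(dotC _ u). Qed.

Lemma dotZr t u v : dot u (t *: v) = t * dot u v.
Proof. by rewrite dotC dotZl dotC. Qed.

Lemma dotNr u v : dot u (- v) = - dot u v.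
Proof. by rewrite dotC dotNl dotC. Qed.

Definition dotE := (dotDl, dotDr, dotNl, dotNr, dotZl, dotZr).

Lemma dot_ge0 u : 0 <= dot u u.
Proof. by apply: sumr_ge0 => i _; rewrite -expr2 sqr_ge0. Qed.

Lemma enorm_sqr u : enorm u ^+ 2 = dot u u.
Proof. by rewrite sqr_sqrtr // dot_ge0. Qed.

Lemma enorm_ge0 u : 0 <= enorm u.
Proof. exact: sqrtr_ge0. Qed.

Lemma enorm0 : enorm (0 : 'rV[R]_n) = 0.
Proof. by rewrite /enorm /dot big1 ?sqrtr0 // => i _; rewrite mxE mul0r. Qed.

Lemma ler_enorm u t : 0 <= t -> (enorm u <= t) = (dot u u <= t ^+ 2).
Proof. by move=> t0; rewrite -enorm_sqr ler_sqr ?nnegrE // enorm_ge0. Qed.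

Lemma enormN u : enorm (- u) = enorm u.
Proof. by rewrite /enorm !dotE opprK. Qed.

Lemma enormB u v : enorm (u - v) = enorm (v - u).
Proof. by rewrite -enormN opprB. Qed.

Lemma enormZ t u : enorm (t *: u) = `|t| * enorm u.
Proof. by rewrite /enorm !dotE mulrA -expr2 sqrtrM ?sqr_ge0 // sqrtr_sqr. Qed.

Lemma dot_young t u v : 0 < t -> 2 * dot u v <= t * dot u u + t^-1 * dot v v.
Proof.
move=> t0; have := dot_ge0 (t *: u - v).
rewrite !dotE (dotC v u) => h.
have : 0 <= t^-1 * (t * (t * dot u u) + t * - dot u v + (- (t * dot u v) - - dot v v)).
  by rewrite mulr_ge0 ?invr_ge0 ?(ltW t0) //; lra.
have -> : t^-1 * (t * (t * dot u u) + t * - dot u v + (- (t * dot u v) - - dot v v)) =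
   t * dot u u - 2 * dot u v + t^-1 * dot v v by field; rewrite gt_eqF.
lra.
Qed.

Lemma cauchy_schwarz u v : dot u v ^+ 2 <= dot u u * dot v v.
Proof.
(* The square of the norm of [dot x x *: y - dot x y *: x]; dividing by [dot x x] gives the claim as
   soon as one of the two vectors is nonzero. *)
have h (x y : 'rV[R]_n) :
    0 <= dot x x * (dot x x * dot y y - dot x y ^+ 2).
  have := dot_ge0 (dot x x *: y - dot x y *: x).
  by rewrite !dotE (dotC y x); congr (_ <= _); ring.
have [u0|u0] := ltP 0 (dot u u).
  by have := h u v; rewrite pmulr_rge0 // subr_ge0.
have [v0|v0] := ltP 0 (dot v v).
  by have := h v u; rewrite pmulr_rge0 // subr_ge0 (dotC v u) mulrC.
have := dot_ge0 (u - v); have := dot_ge0 (u + v).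
have := dot_ge0 u; have := dot_ge0 v.
rewrite !dotE (dotC v u) => v1 u1 h1 h2.
have -> : dot u v = 0 by lra.
by rewrite expr0n /= mulr_ge0.
Qed.

Lemma dot_le_enorm u v : dot u v <= enorm u * enorm v.
Proof.
rewrite (le_trans (ler_norm _)) // -sqrtr_sqr -sqrtrM ?dot_ge0 //.
exact/ler_wsqrtr/cauchy_schwarz.
Qed.

Lemma enormD u v : enorm (u + v) <= enorm u + enorm v.
Proof.
rewrite ler_enorm ?addr_ge0 ?enorm_ge0 // sqrrD !enorm_sqr !dotE (dotC v u).
have := dot_le_enorm u v; lra.
Qed.

Lemma enorm_sub u v : enorm u <= enorm (u - v) + enorm v.
Proof. by rewrite -[X in enorm X <= _](subrK v) enormD. Qed.

Lemma coord_le_enorm u i : `|u 0 i| <= enorm u.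
Proof.
rewrite -sqrtr_sqr; apply: ler_wsqrtr; rewrite /dot (bigD1 i) //= -expr2 lerDl.
by apply: sumr_ge0 => j _; rewrite -expr2 sqr_ge0.
Qed.

Lemma norm_le_enorm u : `|u| <= enorm u.
Proof.
rewrite [`|u|]mx_normrE; apply/bigmax_leP; split=> [|[i j] _ /=].
  exact: enorm_ge0.
by rewrite (ord1 i) coord_le_enorm.
Qed.

(** A crude constant in place of the square root of n: it stays positive for n = 0, so
    [bounded_cluster_point] can divide by it. *)
Lemma enorm_le_norm u : enorm u <= n.+1%:R * `|u|.
Proof.
rewrite ler_enorm ?mulr_ge0 // exprMn.
apply: (@le_trans _ _ (\sum_(i < n) `|u| ^+ 2)).
  apply: ler_sum => i _; rewrite -expr2 -real_normK ?num_real //.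
  rewrite ler_sqr ?nnegrE // [leRHS]mx_normrE.
  exact: (le_bigmax _ (fun ij : 'I_1 * 'I_n => `|u ij.1 ij.2|) (0, i)).
rewrite sumr_const card_ord -[leLHS]mulr_natl ler_wpM2r ?sqr_ge0 //.
by rewrite -natrX ler_nat -mulnn mulnS leqW ?leq_addr // (leq_trans (leqnSn n)) // leq_addr.
Qed.

Lemma bounded_enorm t : bounded_set [set u : 'rV[R]_n | enorm u <= t].
Proof.
exists t; split; first exact: num_real.
by move=> s ts u /= ut; apply: (le_trans (norm_le_enorm u)); rewrite (le_trans ut) // ltW.
Qed.

Lemma enorm_cvg (x : nat -> 'rV[R]_n) u :
  enorm (x k - u) @[k --> \oo] --> (0 : R) -> x k @[k --> \oo] --> u.
Proof.
move=> /cvgrPdist_lt h; apply/cvgrPdist_lt => e e0.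
near=> k; apply: le_lt_trans (norm_le_enorm _) _; rewrite enormB.
have : `|0 - enorm (x k - u)| < e by near: k; exact: h.
by rewrite sub0r normrN ger0_norm // enorm_ge0.
Unshelve. all: by end_near. Qed.

Lemma near_within_enorm (A : set 'rV[R]_n) u (Q : 'rV[R]_n -> Prop) :
  (\forall v \near within A (nbhs u), Q v) ->
  exists2 r : R, 0 < r & forall v, A v -> enorm (v - u) < r -> Q v.
Proof.
move=> /nbhs_ballP [r /= r0 h]; exists r => // v Av vr.
apply: h => //; rewrite mx_norm_ball /ball_ /=.
by rewrite (le_lt_trans (norm_le_enorm _)) // enormB.
Qed.

(** Phrased as being frequently close, so that no subsequence has to be extracted. *)
Definition cluster_point (x : nat -> 'rV[R]_n) u :=
  forall e : R, 0 < e -> forall N, exists2 k, (N <= k)%N & enorm (x k - u) < e.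

Lemma bounded_cluster_point (x : nat -> 'rV[R]_n) t :
  (forall k, enorm (x k) <= t) -> exists u, cluster_point x u.
Proof.
move=> xt.
have K : compact [set v : 'rV[R]_n | `|v| <= t].
  apply: bounded_closed_compact.
    exists t; split; first exact: num_real.
    by move=> s ts u /= ut; rewrite (le_trans ut) // ltW.
  rewrite (_ : [set _ | _] = (fun v : 'rV[R]_n => `|v|) @^-1` [set s | s <= t]) //.
  by apply: closed_comp => [v _|]; [exact: norm_continuous|exact: closed_le].
have [|u [_ ux]] := K (x @ \oo) _.
  by exists 0%N => // k _ /=; rewrite (le_trans (norm_le_enorm _)).
exists u => e e0 N.
have d0 : 0 < e / n.+1%:R by rewrite divr_gt0.
have A : (x @ \oo) [set x k | k in [set k | (N <= k)%N]].
  by exists N => // k /= Nk; exists k.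
have [_ [[k /= Nk <-]]] := ux _ _ A (nbhsx_ballx u _ d0).
rewrite mx_norm_ball /ball_ /= => uk; exists k => //.
by rewrite enormB (le_lt_trans (enorm_le_norm _)) // -ltr_pdivlMl // mulrC.
Qed.

End EuclideanSpace.

(** * Convex functions and proximal points *)

Section ConvexFunctions.
Context {R : realType} {n : nat}.
Implicit Types (A : set 'rV[R]_n) (h : 'rV[R]_n -> R) (u v w x : 'rV[R]_n).
Implicit Types (phi : 'rV[R]_n -> \bar R) (t lam : R).

(* For g and f^* the set A is the domain and h the finite part; values of h
   outside A are junk. *)
Definition convex_on A h := forall x u t, A x -> A u -> 0 <= t <= 1 ->
  A (x + t *: (u - x)) /\ h (x + t *: (u - x)) <= h x + t * (h u - h x).

(** Closedness of the epigraph, with one error for the point and the value. The set [A] itself may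
    fail to be closed: a bound on the values is what puts the limit in [A]. *)
Definition closed_on A h := forall w (c : R),
  (forall e : R, 0 < e -> exists u, [/\ A u, enorm (u - w) < e & h u <= c + e]) ->
  A w /\ h w <= c.

Lemma dom_fineK phi x : (-oo < phi x)%E -> dom phi x -> (fine (phi x))%:E = phi x.
Proof. by rewrite /dom /=; case: (phi x). Qed.

Lemma convex_on_fine phi :
  (forall x, -oo < phi x)%E -> convex_efun phi -> convex_on (dom phi) (fine \o phi).
Proof.
move=> phiN phic x u t xA uA /andP[t0 t1].
have := phic u x t; rewrite t0 t1 => /(_ isT).
have -> : t *: u + (1 - t) *: x = x + t *: (u - x).
  by rewrite scalerBl scale1r scalerBr addrCA.
rewrite -(dom_fineK _ _ (phiN x) xA) -(dom_fineK _ _ (phiN u) uA).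
rewrite -!EFinM -EFinD => le.
have wA : dom phi (x + t *: (u - x)) by rewrite /dom /= (le_lt_trans le) // ltry.
split=> //; move: le; rewrite -(dom_fineK _ _ (phiN _) wA) lee_fin /=; lra.
Qed.

Lemma closed_on_fine phi :
  (forall x, -oo < phi x)%E -> closed_fun phi -> closed_on (dom phi) (fine \o phi).
Proof.
move=> phiN phic w c h.
have : [set p : 'rV[R]_n * R | (phi p.1 <= p.2%:E)%E] (w, c).
  apply: phic => B /nbhs_ballP [e /= e0 Be].
  have [|u [uA uw uc]] := h (e / 2); first by rewrite divr_gt0.
  exists (u, c + e / 2); split => /=.
    by rewrite -(dom_fineK _ _ (phiN u) uA) lee_fin.
  apply: Be; split => /=.
    rewrite mx_norm_ball /ball_ /= (le_lt_trans (norm_le_enorm _)) // enormB.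
    by rewrite (lt_trans uw) // ltr_pdivrMr // ltr_pMr // ltr1n.
  by rewrite /ball /= opprD addrA subrr sub0r normrN gtr0_norm ?divr_gt0 //; lra.
move=> /= wc.
have wA : dom phi w by rewrite /dom /= (le_lt_trans wc) // ltry.
by split=> //=; move: wc; rewrite -(dom_fineK _ _ (phiN w) wA) lee_fin.
Qed.

Lemma conjugate_ge phi x v (c : R) :
  phi x = c%:E -> ((dot x v - c)%:E <= conjugate phi v)%E.
Proof. by move=> xc; apply: ereal_sup_ubound; exists x => //; rewrite xc EFinB. Qed.

Lemma conjugate_le phi v (r : R) : (forall x, -oo < phi x)%E ->
  (forall x (c : R), phi x = c%:E -> dot x v - c <= r) -> (conjugate phi v <= r%:E)%E.
Proof.
move=> phiN h; apply: ge_ereal_sup => _ [x _ <-].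
move: (phiN x) (h x); case: (phi x) => [c _ /(_ c erefl)||] //.
by move=> _ _; rewrite leNye.
Qed.

Lemma proper_fun_finite phi : proper_fun phi -> exists x (c : R), phi x = c%:E.
Proof. by move=> [phiN [x xA]]; exists x, (fine (phi x)); rewrite dom_fineK. Qed.

Lemma conjugate_gtNy phi : proper_fun phi -> forall v, (-oo < conjugate phi v)%E.
Proof.
move=> /proper_fun_finite [x [c xc]] v.
by apply: lt_le_trans (conjugate_ge _ _ v _ xc); rewrite ltNyr.
Qed.

Section Conjugate.
Context (phi : 'rV[R]_n -> \bar R) (phiP : proper_fun phi).
Local Notation conj := (conjugate phi).

Lemma conjugate_fine_ge x v (c : R) :
  phi x = c%:E -> dom conj v -> dot x v - c <= fine (conj v).
Proof.
move=> xc vB; rewrite -lee_fin dom_fineK //; first exact: conjugate_ge.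
exact: conjugate_gtNy.
Qed.

(** A real bound on all the affine functions yields finiteness and the bound at once; convexity and
    closedness of the conjugate are then checked on each affine function separately. *)
Lemma conjugate_fine_le v (r : R) :
  (forall x (c : R), phi x = c%:E -> dot x v - c <= r) ->
  dom conj v /\ fine (conj v) <= r.
Proof.
case: (phiP) => phiN _ /(conjugate_le _ _ _ phiN) le.
have vB : dom conj v by rewrite /dom /= (le_lt_trans le) // ltry.
by split=> //; rewrite -lee_fin dom_fineK //; exact: conjugate_gtNy.
Qed.

Lemma convex_on_conjugate : convex_on (dom conj) (fine \o conj).
Proof.
move=> u v t uB vB /andP[t0 t1]; apply: conjugate_fine_le => x c xc /=.
have := conjugate_fine_ge _ _ _ xc uB; have := conjugate_fine_ge _ _ _ xc vB.
set r := fine _; set s := fine _ => vr us; rewrite !dotE.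
have := ler_wpM2l t0 vr; have : (1 - t) * (dot x u - c) <= (1 - t) * s.
  by rewrite ler_wpM2l // subr_ge0.
nra.
Qed.

Lemma closed_on_conjugate : closed_on (dom conj) (fine \o conj).
Proof.
move=> w c h; apply: conjugate_fine_le => x d xd.
apply/ler_addgt0Pr => e e0.
have k0 : 0 < enorm x + 1 by rewrite ltr_wpDl // enorm_ge0.
have [|v [vB vw vc]] := h (e / (enorm x + 1)); first by rewrite divr_gt0.
have le1 := conjugate_fine_ge _ _ _ xd vB.
have le2 := dot_le_enorm x (w - v); rewrite !dotE enormB in le2.
have le3 : enorm x * enorm (v - w) <= enorm x * (e / (enorm x + 1)).
  by rewrite ler_wpM2l ?enorm_ge0 // ltW.
have : (enorm x + 1) * (e / (enorm x + 1)) = e by rewrite mulrC divfK ?gt_eqF.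
rewrite /= in vc; lra.
Qed.

Lemma conjugate_affine_minorant :
  exists x (c : R), forall v, dom conj v -> dot x v - c <= fine (conj v).
Proof.
have [x [c xc]] := proper_fun_finite _ phiP.
by exists x, c => v; exact: conjugate_fine_ge.
Qed.

End Conjugate.

(** Dividing by k + 1 instead of k covers k = 0. *)
Lemma scaler_small (k e : R) : 0 <= k -> 0 < e -> exists2 d, 0 < d & k * d <= e.
Proof.
move=> k0 e0; have k1 : 0 < k + 1 by rewrite ltr_wpDl.
exists (e / (k + 1)); first by rewrite divr_gt0.
by rewrite mulrA ler_pdivrMr // mulrC ler_pM2l // lerDl.
Qed.

(** Convexity keeps the segment from [x] to [u] inside [A], where the expansion holds. At the point
    of parameter t both the expansion error and the convexity bound are proportional to t, which is
    divided out. *)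
Lemma gradient_within_le A h x u v : convex_on A h -> A x -> A u ->
  is_gradient_within A h x v -> h x + dot v (u - x) <= h u.
Proof.
move=> hc xA uA hv; apply/ler_addgt0Pr => e e0.
have [d d0 de] := scaler_small _ _ (enorm_ge0 (u - x)) e0.
have [r r0 hr] := near_within_enorm _ _ _ (hv _ d0).
have [s s0 sr] := scaler_small _ _ (enorm_ge0 (u - x)) (divr_gt0 r0 (ltr0Sn R 1)).
pose t := Num.min s 1.
have t0 : 0 < t by rewrite lt_min s0 ltr01.
have ts : t <= s by rewrite ge_min lexx.
have [|zA zh] := hc x u t xA uA; first by rewrite (ltW t0) ge_min lexx orbT.
have zx : x + t *: (u - x) - x = t *: (u - x) by rewrite addrAC subrr add0r.
have := hr _ zA; rewrite zx enormZ gtr0_norm // dotZr => /(_ _)/wrap[].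
  have : t * enorm (u - x) <= s * enorm (u - x) by rewrite ler_wpM2r ?enorm_ge0.
  by lra.
rewrite ler_norml => /andP[le1 _].
have : t * (dot v (u - x) - enorm (u - x) * d) <= t * (h u - h x) by lra.
rewrite ler_pM2l //; lra.
Qed.

Lemma proxE lam phi x u : (forall x, -oo < phi x)%E -> dom phi !=set0 ->
  prox lam phi x u -> dom phi u /\ forall v, dom phi v ->
    fine (phi u) + (2 * lam)^-1 * enorm (u - x) ^+ 2 <=
    fine (phi v) + (2 * lam)^-1 * enorm (v - x) ^+ 2.
Proof.
move=> phiN [w wA] pu.
have uA : dom phi u.
  have := pu w; rewrite -(dom_fineK _ _ (phiN w) wA) -EFinD /dom /=.
  by case: (phi u) => [r _||_]; rewrite ?ltry ?ltNyr ?addye ?leye_eq.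
split=> // v vA; have := pu v.
rewrite -(dom_fineK _ _ (phiN u) uA) -(dom_fineK _ _ (phiN v) vA).
by rewrite -!EFinD lee_fin.
Qed.

(** The minimizer is compared with points of the segment towards [v]; after division by the
    parameter t, the only quadratic remainder is at most e. *)
Lemma prox_variational lam phi x u v : (forall x, -oo < phi x)%E ->
  convex_on (dom phi) (fine \o phi) -> 0 < lam -> prox lam phi x u -> dom phi v ->
  lam * (fine (phi u) - fine (phi v)) <= dot (u - x) (v - u).
Proof.
move=> phiN phic lam0 pu vA.
have [uA le] := proxE _ _ _ _ phiN (ex_intro _ _ vA) pu.
apply/ler_addgt0Pr => e e0.
have [s s0 se] := scaler_small _ _ (dot_ge0 (v - u)) e0.
pose t := Num.min s 1.
have t0 : 0 < t by rewrite lt_min s0 ltr01.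
have ts : t <= s by rewrite ge_min lexx.
have [|zA zh] := phic u v t uA vA; first by rewrite (ltW t0) ge_min lexx orbT.
have := le _ zA; rewrite !enorm_sqr.
rewrite (_ : u + t *: (v - u) - x = (u - x) + t *: (v - u)); last by rewrite addrAC.
move: zh => /=; set p := fine _; set a := fine _; set b := fine _ => zh.
move: (u - x) (v - u) se => y z se.
rewrite dotDl !dotDr !dotZl !dotZr (dotC z y) => h.
have := ler_wpM2l (ltW (mulr_gt0 (ltr0Sn R 1) lam0)) h.
have E (c d : R) : 2 * lam * (c + (2 * lam)^-1 * d) = 2 * lam * c + d.
  by rewrite mulrDr mulVKf // gt_eqF // mulr_gt0.
rewrite !E => h1.
have h2 : lam * p <= lam * (a + t * (b - a)) by rewrite ler_wpM2l // ltW.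
have h3 : t * (t * dot z z) <= t * e.
  by rewrite ler_wpM2l ?(ltW t0) // (le_trans _ se) // mulrC ler_wpM2l ?dot_ge0 //.
have : t * (2 * (lam * (a - b))) <= t * (2 * dot y z + e) by lra.
rewrite ler_pM2l //; lra.
Qed.

(** The direct method: an affine minorant plus the quadratic term is coercive, so a minimizing
    sequence has a cluster point, and closedness makes it a minimizer. *)
Lemma prox_exists lam phi x : (forall x, -oo < phi x)%E -> dom phi !=set0 ->
  closed_on (dom phi) (fine \o phi) ->
  (exists z (c : R), forall v, dom phi v -> dot z v - c <= fine (phi v)) ->
  0 < lam -> prox lam phi x !=set0.
Proof.
move=> phiN [w0 w0A] phic [z [c zc]] lam0.
set A := dom phi in phic zc w0A *; set h := fine \o phi in phic zc *.
have k0 : 0 < (2 * lam)^-1 by rewrite invr_gt0 mulr_gt0.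
rewrite /prox; move: (2 * lam)^-1 k0 => k k0.
pose F u := h u + k * dot (u - x) (u - x).
(* Young's inequality absorbs the linear part of the minorant and keeps half of the quadratic term
   for coercivity. *)
pose L := dot z x - c - k^-1 * dot z z.
have FL u : A u -> L + k / 2 * dot (u - x) (u - x) <= F u.
  move=> /zc; rewrite -[fine (phi u)]/(h u) /F /L => le.
  have k1 : 0 < 2 * k^-1 by rewrite mulr_gt0 ?invr_gt0.
  have := dot_young _ z (x - u) k1.
  have -> : dot (x - u) (x - u) = dot (u - x) (u - x) by rewrite -!enorm_sqr enormB.
  have -> : dot z (x - u) = dot z x - dot z u by rewrite !dotE.
  rewrite invfM invrK; have := mulr_ge0 (ltW k0) (dot_ge0 (u - x)); lra.
have Finf : has_inf (F @` A).
  split; first by exists (F w0), w0.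
  exists L => _ [u uA <-]; apply: le_trans (FL u uA).
  by rewrite lerDl mulr_ge0 ?dot_ge0 // divr_ge0 // ltW.
set m := inf (F @` A).
have mF u : A u -> m <= F u by move=> uA; apply: ge_inf; [exact: Finf.2|exists u].
have /choice [u uP] : forall i : nat, exists u, A u /\ F u < m + i.+1%:R^-1.
  move=> i; have [|_ [u uA <-] uF] := inf_adherent (eps := i.+1%:R^-1) _ Finf.
    by rewrite invr_gt0.
  by exists u.
have [i|w wu] := bounded_cluster_point u (Num.sqrt ((m + 1 - L) / (k / 2)) + enorm x).
  apply: (le_trans (enorm_sub (u i) x)); rewrite lerD2r.
  apply: ler_wsqrtr; rewrite ler_pdivlMr ?divr_gt0 // mulrC.
  have [uA uF] := uP i; have := FL _ uA.
  have : (i.+1%:R^-1 : R) <= 1 by rewrite invf_le1 ?ler1n.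
  move: (i.+1%:R^-1) uF => d uF d1 le; lra.
(* This bound on [h w] says that [F w] is at most the infimum. Half of e pays for the gap to the
   infimum, half for the variation of the quadratic term. *)
have [] := phic w (m - k * dot (w - x) (w - x)).
  move=> e e0.
  have e2 : 0 < e / 2 by rewrite divr_gt0.
  have [d d0 de] := scaler_small _ _
    (mulr_ge0 (mulr_ge0 (ler0n R 2) (ltW k0)) (enorm_ge0 (w - x))) e2.
  have d1 : 0 < Num.min d e by rewrite lt_min d0.
  have [i Ni ui] := wu _ d1 (Num.truncn (e / 2)^-1).
  have [uA uF] := uP i; exists (u i).
  move: ui; rewrite lt_min => /andP[ud ue]; split=> //.
  have i2 : i.+1%:R^-1 <= e / 2.
    rewrite -[leRHS]invrK lef_pV2 ?posrE ?invr_gt0 //.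
    have e3 : 0 <= (e / 2)^-1 by rewrite invr_ge0 ltW.
    have /andP[_ lt] := truncn_itv e3.
    by apply/ltW/(lt_le_trans lt); rewrite ler_nat.
  have le1 : dot (w - x) (w - x) - 2 * (enorm (w - x) * enorm (u i - w))
      <= dot (u i - x) (u i - x).
    have -> : u i - x = (w - x) + (u i - w) by rewrite [RHS]addrC addrA subrK.
    move: (w - x) (u i - w) => a b; rewrite dotDl !dotDr (dotC b a).
    have := dot_le_enorm (- a) b; rewrite enormN dotNl.
    have := dot_ge0 b; lra.
  have le2 := ler_wpM2l (ltW k0) le1.
  have le3 : (2 * k * enorm (w - x)) * enorm (u i - w) <= (2 * k * enorm (w - x)) * d.
    by rewrite ler_wpM2l ?(ltW ud) // !mulr_ge0 ?enorm_ge0 // ltW.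
  rewrite /F in uF; move: (i.+1%:R^-1) uF i2 => r uF i2; lra.
move=> wA wm; exists w => v.
rewrite -(dom_fineK _ _ (phiN w) wA) -EFinD.
have [vA|vA] := boolP `[<A v>]; last first.
  have -> : phi v = +oo%E.
    by apply/eqP; rewrite -leye_eq leNgt; apply/negP => /asboolP; exact/negP.
  by rewrite addye // leey.
have /asboolP {}vA := vA.
rewrite -(dom_fineK _ _ (phiN v) vA) -EFinD lee_fin !enorm_sqr.
have := mF v vA; rewrite /F -[fine (phi w)]/(h w) -[fine (phi v)]/(h v); lra.
Qed.

(** Weighting the two variational inequalities by s2 and s1 cancels the values of [phi] and the
    terms in [G]. With P and Q the distances of u1 and u2 to m, Cauchy-Schwarz leaves (s1 Q - s2
    P)(Q - P) <= 0, while s1 Q > s2 P would force Q > P. *)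
Lemma prox_step_ratio phi (s1 s2 : R) m G u1 u2 : (forall x, -oo < phi x)%E ->
  convex_on (dom phi) (fine \o phi) -> dom phi !=set0 -> 0 < s1 <= s2 ->
  prox s1 phi (m + s1 *: G) u1 -> prox s2 phi (m + s2 *: G) u2 ->
  s1 * enorm (u2 - m) <= s2 * enorm (u1 - m).
Proof.
move=> phiN phic phi0 /andP[s10 s12] p1 p2.
have s20 := lt_le_trans s10 s12.
have [u1A _] := proxE _ _ _ _ phiN phi0 p1; have [u2A _] := proxE _ _ _ _ phiN phi0 p2.
have h1 := ler_wpM2l (ltW s20) (prox_variational _ _ _ _ _ phiN phic s10 p1 u2A).
have h2 := ler_wpM2l (ltW s10) (prox_variational _ _ _ _ _ phiN phic s20 p2 u1A).
set a := fine (phi u1) in h1 h2; set b := fine (phi u2) in h1 h2.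
rewrite leNgt; apply/negP => lt.
set p := u1 - m in lt; set r := u2 - m in lt.
have e1 : u1 - (m + s1 *: G) = p - s1 *: G by rewrite opprD addrA.
have e2 : u2 - (m + s2 *: G) = r - s2 *: G by rewrite opprD addrA.
have e3 : u2 - u1 = r - p by rewrite /r /p opprB addrA subrK.
have e4 : u1 - u2 = p - r by rewrite -opprB e3 opprB.
clearbody p r.
rewrite e1 e2 e3 e4 !dotE (dotC r p) in h1 h2.
have := dot_le_enorm p r; rewrite -!enorm_sqr in h1 h2.
have := enorm_ge0 p; have := enorm_ge0 r.
set P := enorm p in lt h1 h2 *; set Q := enorm r in lt h1 h2 *.
move=> Q0 P0 /(ler_wpM2l (ltW (addr_gt0 s10 s20))) le.
have PQ : P < Q.
  by rewrite -(ltr_pM2l s10) (le_lt_trans _ lt) // ler_wpM2r.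
have : 0 < (s1 * Q - s2 * P) * (Q - P) by rewrite mulr_gt0 // subr_gt0.
nra.
Qed.

End ConvexFunctions.

(** [convex_function] only bounds values; that segments stay in [A] is borrowed from [k], which will
    be the finite part of g or of the conjugate of f. *)
Lemma convex_function_on (R : realType) (n : nat) (A : set 'rV[R]_n) (h k : 'rV[R]_n -> R) :
  convex_on A k -> convex_function A h -> convex_on A h.
Proof.
move=> kc hc x u t xA uA t01; have [zA _] := kc x u t xA uA t01.
split=> //; have /andP[t0 t1] := t01.
have := hc (Itv01 t0 t1) u x; rewrite !inE => /(_ uA xA).
rewrite /conv /=.
have -> : t *: u + (1 - t) *: x = x + t *: (u - x).
  by apply/rowP => i; rewrite !mxE; ring.
move=> le; apply: (le_trans le).
change (t * h u + (1 - t) * h x <= h x + t * (h u - h x)); lra.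
Qed.

Lemma gradient_withinN (R : realType) (n : nat) (A : set 'rV[R]_n) (h : 'rV[R]_n -> R) x v :
  is_gradient_within A h x v -> is_gradient_within A (fun u => - h u) x (- v).
Proof.
move=> hv e /hv; apply: filterS => u; rewrite dotNl -normrN.
by congr (`| _ | <= _); ring.
Qed.

(** * Vanishing sequences *)

Lemma near_infty_shift (j : nat) (Q : nat -> Prop) :
  (\forall n \near \oo, Q (n + j)%N) -> \forall n \near \oo, Q n.
Proof.
move=> [N _ hN]; exists (N + j)%N => // n /= Nn.
have jn : (j <= n)%N by rewrite (leq_trans _ Nn) // leq_addl.
by rewrite -(subnK jn); apply: hN => /=; rewrite leq_subRL // addnC.
Qed.

Section VanishingSequences.
Context {R : realType}.
Implicit Types (f g : nat -> R) (e k : R).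

(** One-sided: for nonnegative sequences this is convergence to 0, and upper bounds suffice to prove
    it. *)
Definition vanishes f := forall e, 0 < e -> \forall n \near \oo, f n < e.

Lemma vanishes_le f g : vanishes g -> (\forall n \near \oo, f n <= g n) -> vanishes f.
Proof.
move=> h fg e e0; near=> n.
by apply: le_lt_trans (_ : g n < e); near: n => //; exact: h.
Unshelve. all: by end_near. Qed.

Lemma vanishesD f g : vanishes f -> vanishes g -> vanishes (fun n => f n + g n).
Proof.
move=> hf hg e e0; have e2 : 0 < e / 2 by rewrite divr_gt0.
near=> n.
have : f n < e / 2 by near: n; exact: hf.
have : g n < e / 2 by near: n; exact: hg.
lra.
Unshelve. all: by end_near. Qed.

Lemma vanishes0 : vanishes (fun=> 0).
Proof. by move=> e e0; near=> n. Unshelve. all: by end_near. Qed.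

Lemma vanishesZ k f : 0 <= k -> vanishes f -> vanishes (fun n => k * f n).
Proof.
move=> k0 hf e e0; have [d d0 de] := scaler_small k (e / 2) k0 (divr_gt0 e0 (ltr0Sn R 1)).
near=> n; apply: (@le_lt_trans _ _ (k * d)); last by lra.
by rewrite ler_wpM2l // ltW //; near: n; exact: hf.
Unshelve. all: by end_near. Qed.

Lemma vanishes_shift j f : vanishes (fun n => f (n + j)%N) <-> vanishes f.
Proof.
split=> h e e0; first exact: near_infty_shift j _ (h e e0).
have [N _ hN] := h e e0.
by exists N => // n /= Nn; apply: hN => /=; rewrite (leq_trans Nn) // leq_addr.
Qed.

Lemma vanishes_sum (m : nat) (F : 'I_m -> nat -> R) :
  (forall i, vanishes (F i)) -> vanishes (fun n => \sum_(i < m) F i n).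
Proof.
elim: m F => [|m IH] F hF.
  by apply: vanishes_le vanishes0 _; near=> n; rewrite big_ord0.
apply: vanishes_le (vanishesD _ _ (IH (fun i => F (widen_ord (leqnSn m) i)) _) (hF ord_max)) _.
  by move=> i; exact: hF.
by near=> n; rewrite big_ord_recr.
Unshelve. all: by end_near. Qed.

Lemma vanishes_sqr f : vanishes (fun n => f n ^+ 2) -> vanishes f.
Proof.
move=> h e e0; near=> n; have : f n ^+ 2 < e ^+ 2.
  by near: n; apply: h; rewrite exprn_gt0.
have [f0 _|f0] := ltP (f n) 0; first exact: lt_trans f0 e0.
by rewrite ltr_sqr ?nnegrE ?(ltW e0).
Unshelve. all: by end_near. Qed.

(** Once [g] stays below (1 - k) e / 2, induction gives at most e / 2 plus a geometric term. *)
Lemma vanishes_contraction k f g : 0 <= k < 1 -> (forall n, 0 <= f n) -> vanishes g ->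
  (forall n, f n.+1 <= g n + k * f n) -> vanishes f.
Proof.
move=> /andP[k0 k1] f0 hg fg e e0.
have e1 : 0 < (1 - k) * (e / 2) by rewrite mulr_gt0 ?subr_gt0 ?divr_gt0.
have [N _ hN] := hg _ e1.
have fN j : f (j + N)%N <= e / 2 + k ^+ j * f N.
  elim: j => [|j IH]; first by rewrite add0n expr0 mul1r lerDr divr_ge0 // ltW.
  have := hN (j + N)%N; rewrite /= leq_addl => /(_ isT) gj.
  rewrite addSn (le_trans (fg _)) // exprS.
  have := ler_wpM2l k0 IH; lra.
have [J _ hJ] : \forall j \near \oo, k ^+ j * f N < e / 2.
  have [d d0 de] := scaler_small (f N) (e / 4) (f0 N) (divr_gt0 e0 (ltr0Sn R 3)).
  near=> j; apply: (@le_lt_trans _ _ (d * f N)); last by lra.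
  rewrite ler_wpM2r // ltW //; near: j.
  have : (fun j => k ^+ j) @ \oo --> 0 by apply: cvg_expr; rewrite ger0_norm.
  move=> /cvgrPdist_lt /(_ d d0); apply: filterS => j.
  by rewrite sub0r normrN ger0_norm // exprn_ge0.
exists (J + N)%N => // m /= Jm.
have Nm : (N <= m)%N by rewrite (leq_trans _ Jm) // leq_addl.
have := hJ (m - N)%N; rewrite /= leq_subRL // addnC => /(_ Jm).
have := fN (m - N)%N; rewrite subnK //; lra.
Unshelve. all: by end_near. Qed.

Lemma vanishes_decrement f g : (forall n, 0 <= g n) -> (forall n, 0 <= f n) ->
  (forall n, g n.+1 + f n <= g n) -> vanishes f.
Proof.
move=> g0 f0 gf.
have gn : nonincreasing_seq g.
  by apply/nonincreasing_seqP => n; have := gf n; have := f0 n; lra.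
have /cvg_ex[l gl] : cvgn g.
  by apply: nonincreasing_is_cvgn => //; exists 0 => _ [n _ <-].
have lg : cvgn g by apply/cvg_ex; exists l.
move=> e e0; near=> n.
have : `|l - g n| < e by near: n; move/cvgrPdist_lt : gl; exact.
have : l <= g n.+1 by rewrite -(cvg_lim _ gl) //; exact: nonincreasing_cvgn_ge.
rewrite ltr_norml => le /andP[h _]; have := gf n; lra.
Unshelve. all: by end_near. Qed.

End VanishingSequences.

(** Summation by parts: moving the window by one lowers every weight by one and brings in the newest
    value with weight M. *)
Lemma weighted_sum_shift (R : realType) (r : nat -> R) (M m : nat) :
  \sum_(j < M) j.+1%:R * r (m.+1 + j)%N =
  \sum_(j < M) j.+1%:R * r (m + j)%N + M%:R * r (m + M)%N - \sum_(j < M) r (m + j)%N.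
Proof.
elim: M => [|M IH]; first by rewrite !big_ord0 mul0r addr0 subr0.
rewrite !big_ord_recr /= IH addSnnS -(natr1 M); ring.
Qed.

(** * One-step descent *)

Section DescentInequalities.
Context {R : realType} {n : nat}.

(* The golden-ratio relations turn all differences into combinations of
   xp - x, x - z1 and z1 - w; the rest is three instances of Young's inequality. *)
Lemma primal_descent (a psi xi phi xi1 delta om : R) (xm x xp z0 z1 z2 w t : 'rV[R]_n) :
  0 < a < 1 -> 1 < psi -> 0 < xi -> 0 < xi1 -> 0 < delta <= phi ->
  om = (1 - a) * (2 * psi - xi - psi ^+ 3 * phi / (1 + psi)) - a / xi1 ->
  z1 = ((psi - 1) / psi) *: x + psi^-1 *: z0 ->
  z2 = ((psi - 1) / psi) *: xp + psi^-1 *: z1 ->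
  2 * (dot (xp - (a *: x + (1 - a) *: z1)) (w - xp)
       + delta * dot (x - (a *: xm + (1 - a) *: z0)) (xp - x) + dot t (x - xp))
  <= a * dot (x - w) (x - w) + (1 - a) * (psi / (psi - 1)) * dot (z1 - w) (z1 - w)
   - (a * dot (xp - w) (xp - w) + (1 - a) * (psi / (psi - 1)) * dot (z2 - w) (z2 - w))
   - (a + om * delta) * dot (xp - x) (xp - x)
   + a * delta * xi1 * dot (x - xm) (x - xm)
   + (delta * ((1 - a) * xi))^-1 * dot t t.
Proof.
move=> /andP[a0 a1] psi1 xi0 xi10 /andP[d0 dphi] omE z1E z2E.
have psi0 : 0 < psi by lra.
have a1' : 0 < 1 - a by lra.
have psin0 : psi != 0 by rewrite gt_eqF.
have z0E : x - z0 = psi *: (x - z1).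
  by rewrite z1E; apply/rowP => i; rewrite !mxE; field.
have z2E' : z2 - w = (z1 - w) + ((psi - 1) / psi) *: ((xp - x) + (x - z1)).
  by rewrite z2E; apply/rowP => i; rewrite !mxE; field.
have -> : xp - (a *: x + (1 - a) *: z1) = a *: (xp - x) + (1 - a) *: ((xp - x) + (x - z1)).
  by apply/rowP => i; rewrite !mxE; ring.
have -> : x - (a *: xm + (1 - a) *: z0) = a *: (x - xm) + (1 - a) *: (psi *: (x - z1)).
  by rewrite -z0E; apply/rowP => i; rewrite !mxE; ring.
have -> : w - xp = - ((xp - x) + (x - z1) + (z1 - w)).
  by apply/rowP => i; rewrite !mxE; ring.
have -> : x - xp = - (xp - x) by rewrite opprB.
have -> : x - w = (x - z1) + (z1 - w) by rewrite addrA subrK.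
have -> : xp - w = (xp - x) + (x - z1) + (z1 - w)
  by apply/rowP => i; rewrite !mxE; ring.
rewrite z2E' {z0E z1E z2E z2E'}.
move: (xp - x) (x - z1) (z1 - w) (x - xm) => u v c e.
rewrite !dotE (dotC v u) (dotC c u) (dotC c v).
(* The weights are read off from [om]: they produce the terms in 1 / xi1, in xi and in psi^3 / (1 +
   psi). The third one yields delta^2, which [Y4] trades for phi * delta. *)
have Y1 := dot_young xi1 e u xi10.
have Y2 := dot_young (delta * ((1 - a) * xi)) u (- t) (mulr_gt0 d0 (mulr_gt0 a1' xi0)).
have Y3 := dot_young ((1 + psi) / psi) (u + v) ((delta * psi) *: u)
  (divr_gt0 (addr_gt0 ltr01 psi0) psi0).
have Y4 : 0 <= (phi - delta) * delta * psi ^+ 3 / (1 + psi) * dot u u.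
  by rewrite !mulr_ge0 ?dot_ge0 ?exprn_ge0 ?invr_ge0 ?subr_ge0 //; lra.
rewrite !dotE in Y2; rewrite !dotE (dotC v u) in Y3.
rewrite (dotC u t) in Y2; rewrite -subr_ge0 in Y1; rewrite -subr_ge0 in Y2; rewrite -subr_ge0 in Y3.
(* The slack in the claim is exactly this nonnegative combination. *)
have S := addr_ge0 (addr_ge0 (mulr_ge0 (ltW (mulr_gt0 a0 d0)) Y1) Y2)
  (mulr_ge0 (ltW a1') (addr_ge0 Y3 Y4)).
rewrite -subr_ge0; move: S; congr (_ <= _); rewrite omE; field.
rewrite !gt_eqF //; lra.
Qed.

(** Three-point identities at [ym] and [zb], weighted by b and 1 - b; expanding the square at the
    convex combination [zb1] then makes the distances to [v] telescope. *)
Lemma dual_descent (b : R) (ym yn zb zb1 v : 'rV[R]_n) :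
  zb1 = (1 - b) *: yn + b *: zb ->
  2 * dot (yn - (b *: ym + (1 - b) *: zb)) (v - yn) =
  b * dot (ym - v) (ym - v) + dot (zb - v) (zb - v)
  - (b * dot (yn - v) (yn - v) + dot (zb1 - v) (zb1 - v))
  - b * dot (yn - ym) (yn - ym) - (1 - b) * (1 + b) * dot (yn - zb) (yn - zb).
Proof.
move=> ->; rewrite !dotE (dotC v yn) (dotC v ym) (dotC v zb) (dotC zb yn) (dotC ym yn).
ring.
Qed.

End DescentInequalities.

(** * Saddle-point data *)

Section SaddleData.
Context {R : realType} {q p : nat} (D : saddle_data R q p) (hD : admissible_data D).
Local Notation g := (sd_g D).
Local Notation fs := (conjugate (sd_f D)).
Local Notation Phi := (sd_Phi D).
Local Notation gradx := (sd_gradx D).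
Local Notation grady := (sd_grady D).
Local Notation A := (dom g).
Local Notation B := (dom fs).
Local Notation G := (fine \o g).
Local Notation H := (fine \o fs).

Lemma sd_g_gtNy u : (-oo < g u)%E.
Proof. by have [[]] := adm_g hD. Qed.

Lemma sd_fs_gtNy v : (-oo < fs v)%E.
Proof. by have [fP _ _] := adm_f hD; exact: conjugate_gtNy. Qed.

Lemma sd_g_convex : convex_on A G.
Proof. by have [[gN _] _ gc] := adm_g hD; exact: convex_on_fine. Qed.

Lemma sd_fs_convex : convex_on B H.
Proof. by have [fP _ _] := adm_f hD; exact: convex_on_conjugate. Qed.

Lemma sd_g_closed : closed_on A G.
Proof. by have [[gN _] gc _] := adm_g hD; exact: closed_on_fine. Qed.

Lemma sd_fs_closed : closed_on B H.
Proof. by have [fP _ _] := adm_f hD; exact: closed_on_conjugate. Qed.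

Lemma sd_Phi_gradx x u y : A x -> A u -> B y ->
  Phi x y + dot (gradx x y) (u - x) <= Phi u y.
Proof.
move=> xA uA yB; apply: (gradient_within_le A (fun z => Phi z y)) => //.
  exact: convex_function_on sd_g_convex (adm_convex hD yB).
exact: adm_gradx.
Qed.

Lemma sd_Phi_grady x y v : A x -> B y -> B v ->
  Phi x v <= Phi x y + dot (grady x y) (v - y).
Proof.
move=> xA yB vB.
have := gradient_within_le B (fun z => - Phi x z) y v (- grady x y).
rewrite dotNl -opprD lerN2; apply=> //.
  exact: convex_function_on sd_fs_convex (adm_concave hD xA).
by apply: gradient_withinN; exact: adm_grady.
Qed.

(** This is L(x, v) - L(u, y) on finite parts. *)
Definition duality_gap u v x y := G x - G u + H y - H v + Phi x v - Phi u y.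

Lemma lagrangian_fine x y : A x -> B y -> lagrangian D x y = (G x + Phi x y - H y)%:E.
Proof.
move=> xA yB; rewrite /lagrangian.
by rewrite -(dom_fineK g x (sd_g_gtNy x) xA) -(dom_fineK fs y (sd_fs_gtNy y) yB).
Qed.

Lemma saddle_gap_ge0 u v x y : saddle_points D (u, v) -> A x -> B y ->
  0 <= duality_gap u v x y.
Proof.
move=> [/= uA vB h] xA yB; have [] := h x y xA yB.
rewrite !lagrangian_fine // !lee_fin /duality_gap /=; lra.
Qed.

Lemma sd_Phi_continuous x y (e : R) : A x -> B y -> 0 < e ->
  exists2 r : R, 0 < r & forall x' y', A x' -> B y' ->
    enorm (x' - x) < r -> enorm (y' - y) < r -> `|Phi x' y' - Phi x y| < e.
Proof.
move=> xA yB e0.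
have /subspace_continuousP /(_ (x, y) (conj xA yB)) := adm_continuous hD.
move=> /cvgrPdist_lt /(_ e e0) /nbhs_ballP[r /= r0 hr]; exists r => // x' y' xA' yB' xr yr.
rewrite distrC; apply: (hr (x', y')) => //; split => /=;
by rewrite mx_norm_ball /ball_ /= (le_lt_trans (norm_le_enorm _)) // enormB.
Qed.

End SaddleData.

(** * The algorithm *)

Section NPDAL.
Context {R : realType} {q p : nat} (D : saddle_data R q p) (hD : admissible_data D).
Context (P : npdal_params R) (hP : admissible_params P).
Context (S : iterates R q p) (hS : npdal_generated D P S).
Local Notation g := (sd_g D).
Local Notation fs := (conjugate (sd_f D)).
Local Notation Phi := (sd_Phi D).
Local Notation gradx := (sd_gradx D).
Local Notation grady := (sd_grady D).
Local Notation A := (dom g).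
Local Notation B := (dom fs).
Local Notation G := (fine \o g).
Local Notation H := (fine \o fs).
Local Notation x := (it_x S).
Local Notation z := (it_z S).
Local Notation y := (it_y S).
Local Notation zb := (it_zb S).
Local Notation tau := (it_tau S).
Local Notation delta := (it_delta S).
Local Notation psi := (npsi P).
Local Notation a := (na P).
Local Notation b := (nb P).
Local Notation beta := (nbeta P).
Local Notation xi := (nxi P).
Local Notation xi1 := (nxi1 P).
Local Notation nu := (nnu P).
Local Notation mu := (nmu P).
Local Notation eta := (neta P).
Local Notation M := (nM P).
Local Notation gap := (duality_gap D).
Local Notation r n := (ls_r P S n (y n)).
Local Notation dx n := (enorm (x n.+1 - x n)).

(** * Step sizes and feasibility of the iterates *)

Lemma tau_gt0 n : 0 < tau n.
Proof.
elim: n => [|n IH]; first by rewrite (gen_tau0 hS); have /andP[] := ap_tau0 hP.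
have [i [-> _ _ _]] := gen_linesearch hS (ltn0Sn n).
have /andP[mu0 _] := ap_mu hP; have /andP[phi1 _] := ap_phi hP.
rewrite mulr_gt0 ?exprn_gt0 // /tau_start lt_min (ap_taumax hP) andbT.
by rewrite mulr_gt0 // (lt_trans ltr01).
Qed.

Lemma tau_start_gt0 n : 0 < tau_start P S n.
Proof.
have /andP[phi1 _] := ap_phi hP.
rewrite /tau_start lt_min (ap_taumax hP) andbT.
by rewrite mulr_gt0 ?tau_gt0 // (lt_trans ltr01).
Qed.

Lemma tau_le_start n : tau n.+1 <= tau_start P S n.+1.
Proof.
have [i [-> _ _ _]] := gen_linesearch hS (ltn0Sn n).
have /andP[mu0 mu1] := ap_mu hP.
by rewrite ler_piMr ?exprn_ile1 ?ltW // tau_start_gt0.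
Qed.

Lemma tau_le_max n : tau n <= ntaumax P.
Proof.
case: n => [|n]; first by rewrite (gen_tau0 hS); have /andP[] := ap_tau0 hP.
by rewrite (le_trans (tau_le_start n)) // /tau_start ge_min lexx orbT.
Qed.

Lemma delta_gt0 n : 0 < delta n.
Proof.
case: n => [|n]; first by rewrite (gen_delta0 hS) (ap_delta0 hP).
by rewrite (gen_delta hS) // divr_gt0 // tau_gt0.
Qed.

Lemma delta_le n : delta n.+1 <= nphi P.
Proof.
rewrite (gen_delta hS) // ler_pdivrMr ?tau_gt0 // (le_trans (tau_le_start n)) //.
by rewrite /tau_start ge_min lexx.
Qed.

Lemma y_prox n :
  prox (beta * tau n.+1) fs (y_md P S n.+1 + (beta * tau n.+1) *: grady (x n.+1) (y n)) (y n.+1).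
Proof. by have [i []] := gen_linesearch hS (ltn0Sn n). Qed.

Lemma dom_g_neq0 : A !=set0.
Proof. by exists (x 0%N); exact: gen_x0 hS. Qed.

Lemma dom_fs_neq0 : B !=set0.
Proof. by exists (y 0%N); exact: gen_y0 hS. Qed.

Lemma x_dom n : A (x n).
Proof.
case: n => [|n]; first exact: gen_x0 hS.
by have [] := proxE _ _ _ _ (sd_g_gtNy D hD) dom_g_neq0 (gen_x hS (ltn0Sn n)).
Qed.

Lemma y_dom n : B (y n).
Proof.
case: n => [|n]; first exact: gen_y0 hS.
by have [] := proxE _ _ _ _ (sd_fs_gtNy D hD) dom_fs_neq0 (y_prox n).
Qed.

(** * Proximal inequalities and descent along the iterates *)

Lemma x_step n u : A u ->
  tau n * (G (x n.+1) - G u) <=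
  dot (x n.+1 - x_md P S n.+1) (u - x n.+1) + tau n * dot (gradx (x n) (y n)) (u - x n.+1).
Proof.
move=> uA.
have := prox_variational _ _ _ _ _ (sd_g_gtNy D hD) (sd_g_convex D hD) (tau_gt0 n)
  (gen_x hS (ltn0Sn n)) uA.
by rewrite opprB addrA addrAC !dotDl dotZl.
Qed.

Lemma y_step n v : B v ->
  tau n.+1 * (H (y n.+1) - H v) <=
  beta^-1 * dot (y n.+1 - y_md P S n.+1) (v - y n.+1)
  - tau n.+1 * dot (grady (x n.+1) (y n)) (v - y n.+1).
Proof.
move=> vB; have b0 := ap_beta hP.
have bt : 0 < beta * tau n.+1 by rewrite mulr_gt0 // tau_gt0.
have := prox_variational _ _ _ _ _ (sd_fs_gtNy D hD) (sd_fs_convex D hD) bt (y_prox n) vB.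
rewrite opprD addrA !dotDl !dotNl dotZl => le.
rewrite -(ler_pM2l b0) mulrA (le_trans le) // mulrBr mulVKf ?gt_eqF //.
by rewrite mulrA.
Qed.

(** Concavity in y replaces the gradient at [y n] by values of [Phi], at the price of the
    linearization error that the line search controls. *)
Lemma y_step_Phi n v : B v ->
  tau n.+1 * (H (y n.+1) - H v + Phi (x n.+1) v - Phi (x n.+1) (y n.+1)) <=
  beta^-1 * dot (y n.+1 - y_md P S n.+1) (v - y n.+1)
  + tau n.+1 * ls_Phi D S n.+1 (y n.+1).
Proof.
move=> vB; have := y_step n v vB.
have := sd_Phi_grady D hD _ _ _ (x_dom n.+1) (y_dom n) vB.
rewrite /ls_Phi /= -(ler_pM2l (tau_gt0 n.+1)).
have -> : v - y n = (v - y n.+1) + (y n.+1 - y n) by rewrite addrA subrK.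
rewrite dotDr; lra.
Qed.

(* This is F_(n+1) for the target (u, v). *)
Definition lyap u v n :=
  a * dot (x n.+1 - u) (x n.+1 - u)
  + (1 - a) * (psi / (psi - 1)) * dot (z n.+2 - u) (z n.+2 - u)
  + beta^-1 * (b * dot (y n - v) (y n - v) + dot (zb n.+1 - v) (zb n.+1 - v))
  + (a + omega1 P * delta n) * dot (x n.+1 - x n) (x n.+1 - x n).

Lemma one_step_descent u v n : A u -> B v ->
  lyap u v n.+1 + 2 * tau n.+1 * gap u v (x n.+1) (y n.+1)
  + a * (1 - nphi P * xi1) * dot (x n.+1 - x n) (x n.+1 - x n)
  + (1 - nu) * r n.+1
  <= lyap u v n + (1 - nu) * ls_c P S n.+1.
Proof.
move=> uA vB.
have [a0 a1] := andP (ap_a hP); have [psi1 _] := andP (ap_psi hP).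
have [xi10 _] := andP (ap_xi1 hP).
have t0 := tau_gt0 n; have t1 := tau_gt0 n.+1.
have d0 := delta_gt0 n.+1; have dE := gen_delta hS (ltn0Sn n); rewrite /= in dE.
have d1 : 0 < delta n.+1 <= nphi P by rewrite d0 delta_le.
have [_ [_ _ acc _]] := gen_linesearch hS (ltn0Sn n).
rewrite /ls_accept /= in acc.
pose th := ls_theta D S n.+1 (y n.+1).
have PD := primal_descent a psi xi (nphi P) xi1 (delta n.+1) (omega1 P)
  (x n) (x n.+1) (x n.+2) (z n.+1) (z n.+2) (z n.+3) u (tau n.+1 *: th)
  (ap_a hP) psi1 (ap_xi hP) xi10 d1 erefl (gen_z hS (ltn0Sn n.+1)) (gen_z hS (ltn0Sn n.+2)).
have DD := dual_descent b (y n) (y n.+1) (zb n.+1) (zb n.+2) v (gen_zb hS (ltn0Sn n.+1)).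
have XS := x_step n.+1 u uA; rewrite /= in XS.
(* The prox inequality of the previous x-step, tested at the new point. The factor [delta n.+1]
   converts [tau n] into [tau n.+1], so that the two gradients combine into [th]. *)
have XO := ler_wpM2l (ltW d0) (x_step n _ (x_dom n.+2)).
have YS := y_step_Phi n v vB.
have GX := sd_Phi_gradx D hD _ _ _ (x_dom n.+1) uA (y_dom n.+1).
rewrite -(ler_pM2l t1) in GX.
have E1 : (delta n.+1 * ((1 - a) * xi))^-1 * dot (tau n.+1 *: th) (tau n.+1 *: th) =
    tau n.+1 * tau n / ((1 - a) * xi) * enorm th ^+ 2.
  rewrite enorm_sqr !dotE dE; field.
  by rewrite !gt_eqF ?(ap_xi hP) // ?subr_gt0.
rewrite {}E1 dotZl in PD.
have dt w : delta n.+1 * (tau n * w) = tau n.+1 * w by rewrite mulrA dE divfK // gt_eqF.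
rewrite [leRHS]mulrDr !dt in XO.
have r0 : a * delta n.+1 * xi1 * dot (x n.+1 - x n) (x n.+1 - x n) <=
    a * nphi P * xi1 * dot (x n.+1 - x n) (x n.+1 - x n).
  rewrite ler_wpM2r ?dot_ge0 // ler_wpM2r ?(ltW xi10) // ler_wpM2l ?(ltW a0) //.
  exact: delta_le.
rewrite -/th in acc.
(* The x-part of [r] is stored in [lyap u v n] and the y-parts come from [dual_descent]. The line
   search spends the fraction nu of it; 1 - nu remains. *)
have rE : r n.+1 = omega1 P * delta n * dot (x n.+1 - x n) (x n.+1 - x n)
   + beta^-1 * (b * dot (y n.+1 - y n) (y n.+1 - y n)
   + (1 - b) * (1 + b) * dot (y n.+1 - zb n.+1) (y n.+1 - zb n.+1)).
  by rewrite /ls_r /= !enorm_sqr; lra.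
have DD' := congr1 ( *%R beta^-1) DD.
have E2 : dot th (x n.+1 - x n.+2) = dot (gradx (x n.+1) (y n.+1)) (x n.+1 - x n.+2)
   - dot (gradx (x n) (y n)) (x n.+1 - x n.+2) by rewrite /th /ls_theta /= dotDl dotNl.
have E3 : dot (gradx (x n) (y n)) (x n.+1 - x n.+2) = - dot (gradx (x n) (y n)) (x n.+2 - x n.+1).
  by rewrite -dotNr opprB.
have E4 : dot (gradx (x n.+1) (y n.+1)) (u - x n.+1) =
   dot (gradx (x n.+1) (y n.+1)) (u - x n.+2) - dot (gradx (x n.+1) (y n.+1)) (x n.+1 - x n.+2).
  by rewrite -dotNr -dotDr opprB addrA subrK.
rewrite E2 E3 in PD; rewrite E4 in GX.
rewrite /x_md /= in XS XO; rewrite /y_md /= in YS.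
rewrite /duality_gap /lyap.
rewrite rE in acc *.
rewrite /= in XS XO YS acc *.
move: (enorm th ^+ 2) acc PD => th2 acc PD.
move: DD' PD XS XO YS GX acc r0.
lra.
Qed.

(** * The potential of the nonmonotone line search *)

Lemma ls_r_ge0 n v : 0 <= ls_r P S n v.
Proof.
have /andP[b0 b1] := ap_b hP; have beta0 := ap_beta hP.
have o0 := ltW (ap_omega1 hP); have d0 := ltW (delta_gt0 n.-1).
have b2 : 0 <= 1 - b by rewrite subr_ge0 ltW.
have b3 : 0 <= 1 + b by rewrite addr_ge0.
have bi : 0 <= beta^-1 by rewrite invr_ge0 ltW.
exact: (addr_ge0 (addr_ge0 (mulr_ge0 (mulr_ge0 o0 d0) (sqr_ge0 _))
  (mulr_ge0 (mulr_ge0 b0 bi) (sqr_ge0 _)))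
  (mulr_ge0 (mulr_ge0 (mulr_ge0 bi b2) b3) (sqr_ge0 _))).
Qed.

(** From index M + 1 on the averaging window is full, with exactly M terms; hence the shift by M in
    the potential. *)
Lemma ls_cE m : ls_c P S (m + M).+1 = eta / M%:R * \sum_(j < M) r (m.+1 + j)%N.
Proof.
have M0 := ap_M hP.
rewrite /ls_c ltnS leqNgt addn_gt0 M0 orbT /=.
rewrite -addSn addnK (maxn_idPl _) // addKn; congr (_ * _).
rewrite -{1}[m.+1]add0n big_addn addKn big_mkord.
by apply: eq_bigr => i _; rewrite addnC.
Qed.

Lemma ls_c_ge0 m : 0 <= ls_c P S (m + M).+1.
Proof.
have /andP[eta0 _] := ap_eta hP.
rewrite ls_cE mulr_ge0 ?divr_ge0 //; apply: sumr_ge0 => i _; exact: ls_r_ge0.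
Qed.

Definition window m := \sum_(j < M) j.+1%:R * r (m.+1 + j)%N.

(* The window sum is the discrete integral of the nonmonotone line search
   slack: window m.+1 - window m = M * (r_(m+M+1) - average of the last M r's). *)
Definition potential u v m :=
  lyap u v (m + M) + (1 - nu) * (eta / M%:R) * window m.

Lemma window_ge0 m : 0 <= window m.
Proof. by apply: sumr_ge0 => i _; rewrite mulr_ge0 ?ls_r_ge0. Qed.

Lemma lyap_coeff_gt0 : 0 < (1 - a) * (psi / (psi - 1)).
Proof.
have /andP[a0 a1] := ap_a hP; have /andP[psi1 _] := ap_psi hP.
rewrite mulr_gt0 ?divr_gt0 ?subr_gt0 //; exact: lt_trans psi1.
Qed.

Lemma lyap_ge u v n : a * dot (x n.+1 - u) (x n.+1 - u) +
  beta^-1 * dot (zb n.+1 - v) (zb n.+1 - v) <= lyap u v n.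
Proof.
have /andP[a0 a1] := ap_a hP; have /andP[b0 b1] := ap_b hP.
have beta0 := ap_beta hP.
have h1 := mulr_ge0 (ltW lyap_coeff_gt0) (dot_ge0 (z n.+2 - u)).
have bi : 0 <= beta^-1 by rewrite invr_ge0 ltW.
have h2 := mulr_ge0 bi (mulr_ge0 b0 (dot_ge0 (y n - v))).
have od := mulr_ge0 (ltW (ap_omega1 hP)) (ltW (delta_gt0 n)).
have h3 := mulr_ge0 (addr_ge0 (ltW a0) od) (dot_ge0 (x n.+1 - x n)).
rewrite /lyap; lra.
Qed.

Lemma potential_ge u v m : lyap u v (m + M) <= potential u v m.
Proof.
have /andP[eta0 _] := ap_eta hP; have /andP[nu0 nu1] := ap_nu hP.
by rewrite lerDl mulr_ge0 ?window_ge0 // mulr_ge0 ?divr_ge0 // subr_ge0 ltW.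
Qed.

Lemma potential_ge0 u v m : 0 <= potential u v m.
Proof.
have /andP[a0 a1] := ap_a hP; have beta0 := ap_beta hP.
rewrite (le_trans _ (potential_ge u v m)) // (le_trans _ (lyap_ge u v _)) //.
by rewrite addr_ge0 // mulr_ge0 ?dot_ge0 ?invr_ge0 // ltW.
Qed.

(** Moving the window absorbs (1 - nu) c and costs (1 - nu) eta r for the newest r; as eta < 1, part
    of the (1 - nu) r from the one-step descent is left. *)
Lemma potential_decrease u v m : saddle_points D (u, v) ->
  potential u v m.+1
  + (a * (1 - nphi P * xi1) * dx (m + M) ^+ 2 + (1 - nu) * (1 - eta) * r (m + M).+1)
  <= potential u v m.
Proof.
move=> uv; have [/= uA vB _] := uv.
have gap0 := saddle_gap_ge0 D hD _ _ _ _ uv (x_dom (m + M).+1)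
  (y_dom (m + M).+1).
have t0 := tau_gt0 (m + M).+1.
have := one_step_descent u v (m + M) uA vB.
have := mulr_ge0 (mulr_ge0 (ler0n R 2) (ltW t0)) gap0.
rewrite /potential /window (weighted_sum_shift _ (fun n => r n) M m.+1) ls_cE enorm_sqr addSn.
set W := \sum_(j < M) j.+1%:R * _; set V := \sum_(j < M) ls_r _ _ _ _.
have M0 : M%:R != 0 :> R by rewrite pnatr_eq0 -lt0n (ap_M hP).
have -> : (1 - nu) * (eta / M%:R) * (W + M%:R * r (m.+1 + M)%N - V) =
   (1 - nu) * (eta / M%:R) * W + (1 - nu) * eta * r (m.+1 + M)%N - (1 - nu) * (eta / M%:R * V).
  by field.
rewrite addSn; lra.
Qed.

Lemma decrease_coeff_gt0 : 0 < a * (1 - nphi P * xi1) /\ 0 < (1 - nu) * (1 - eta).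
Proof.
have /andP[a0 a1] := ap_a hP; have /andP[eta0 eta1] := ap_eta hP.
have /andP[nu0 nu1] := ap_nu hP; have /andP[xi10 xi11] := ap_xi1 hP.
have /andP[phi1 _] := ap_phi hP; have phi0 := lt_trans ltr01 phi1.
have h : nphi P * xi1 < 1 by rewrite -(ltr_pdivlMl _ _ phi0) mulr1.
by split; rewrite mulr_gt0 // subr_gt0.
Qed.

Lemma decrease_ge0 m :
  0 <= a * (1 - nphi P * xi1) * dx (m + M) ^+ 2 + (1 - nu) * (1 - eta) * r (m + M).+1.
Proof.
have [k1 k2] := decrease_coeff_gt0.
exact: addr_ge0 (mulr_ge0 (ltW k1) (sqr_ge0 _)) (mulr_ge0 (ltW k2) (ls_r_ge0 _ _)).
Qed.

Lemma potential_nonincreasing u v m k : saddle_points D (u, v) -> (m <= k)%N ->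
  potential u v k <= potential u v m.
Proof.
move=> uv /subnK <-; elim: (k - m)%N => [|j IH] //.
apply: le_trans IH; rewrite addSn; apply: le_trans (potential_decrease u v _ uv).
by rewrite lerDl decrease_ge0.
Qed.

(** * Vanishing differences and boundedness *)

Lemma vanishes_dx_r : vanishes (fun n => dx n) /\ vanishes (fun n => r n).
Proof.
have [[u v] uv _] := adm_saddle hD.
have [k1 k2] := decrease_coeff_gt0.
have V := vanishes_decrement _ _ (potential_ge0 u v) decrease_ge0
  (fun m => potential_decrease u v m uv).
split.
  apply/vanishes_sqr/(vanishes_shift M (fun n => dx n ^+ 2)).
  have ki : 0 <= (a * (1 - nphi P * xi1))^-1 by rewrite invr_ge0 ltW.
  apply: vanishes_le (vanishesZ _ _ ki V) _; apply: nearW => m.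
  by rewrite -(ler_pM2l k1) mulVKf ?gt_eqF // lerDl mulr_ge0 ?ls_r_ge0 ?(ltW k2).
apply/(vanishes_shift M.+1 (fun n => r n)).
have ki : 0 <= ((1 - nu) * (1 - eta))^-1 by rewrite invr_ge0 ltW.
apply: vanishes_le (vanishesZ _ _ ki V) _; apply: nearW => m.
by rewrite -(ler_pM2l k2) mulVKf ?gt_eqF // addnS lerDr mulr_ge0 ?sqr_ge0 ?(ltW k1).
Qed.

Lemma vanishes_y_zb : vanishes (fun n => enorm (y n - zb n)).
Proof.
have [_ rV] := vanishes_dx_r.
have /andP[b0 b1] := ap_b hP; have beta0 := ap_beta hP.
have k0 : 0 < beta^-1 * (1 - b) * (1 + b).
  by rewrite !mulr_gt0 ?invr_gt0 ?subr_gt0 //; lra.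
have ki : 0 <= (beta^-1 * (1 - b) * (1 + b))^-1 by rewrite invr_ge0 ltW.
apply: vanishes_sqr; apply: vanishes_le (vanishesZ _ _ ki rV) _; apply: nearW => n.
have o0 := ltW (ap_omega1 hP); have d0 := ltW (delta_gt0 n.-1).
rewrite -(ler_pM2l k0) mulVKf ?gt_eqF // /ls_r lerDr.
have bi : 0 <= beta^-1 by rewrite invr_ge0 ltW.
exact: addr_ge0 (mulr_ge0 (mulr_ge0 o0 d0) (sqr_ge0 _))
  (mulr_ge0 (mulr_ge0 b0 bi) (sqr_ge0 _)).
Qed.

Lemma vanishes_zb_y : vanishes (fun n => enorm (zb n.+1 - y n)).
Proof.
have /andP[b0 b1] := ap_b hP.
apply: vanishes_le (vanishesZ b _ b0 vanishes_y_zb) _; apply: nearW => n.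
rewrite (gen_zb hS) //= (_ : _ - _ = - b *: (y n - zb n)).
  by rewrite enormZ normrN ger0_norm.
by apply/rowP => i; rewrite !mxE; ring.
Qed.

(** The detour through [zb n.+1] covers b = 0, where the term of [r] in this increment has
    coefficient zero. *)
Lemma vanishes_dy : vanishes (fun n => enorm (y n.+1 - y n)).
Proof.
have V : vanishes (fun n => enorm (y n.+1 - zb n.+1)).
  have := vanishes_y_zb; rewrite -(vanishes_shift 1) => V e /V.
  by apply: filterS => n; rewrite addn1.
apply: vanishes_le (vanishesD _ _ V vanishes_zb_y) _; apply: nearW => n.
by rewrite (le_trans _ (enormD _ _)) // addrA subrK.
Qed.

Lemma vanishes_y_md : vanishes (fun n => enorm (y n.+1 - y_md P S n.+1)).
Proof.
have /andP[b0 b1] := ap_b hP.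
have b2 : 0 <= 1 - b by rewrite subr_ge0 ltW.
apply: vanishes_le (vanishesD _ _ vanishes_dy (vanishesZ _ _ b2 vanishes_zb_y)) _.
apply: nearW => n; rewrite (_ : _ - _ = (y n.+1 - y n) + (- (1 - b)) *: (zb n.+1 - y n)).
  by rewrite (le_trans (enormD _ _)) // enormZ normrN ger0_norm.
by rewrite /y_md /=; apply/rowP => i; rewrite !mxE; ring.
Qed.

(** The averaging rule for z shrinks x - z by the factor 1 / psi at each step, up to a vanishing
    increment of x. *)
Lemma vanishes_x_z : vanishes (fun n => enorm (x n.+1 - z n.+1)).
Proof.
have /andP[psi1 _] := ap_psi hP; have psi0 := lt_trans ltr01 psi1.
have [dxV _] := vanishes_dx_r.
have k : 0 <= psi^-1 < 1 by rewrite invr_ge0 (ltW psi0) invf_lt1.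
apply: (vanishes_contraction _ _ (fun n => dx n.+1) k) => [n|e e0|n].
- exact: enorm_ge0.
- have := dxV; rewrite -(vanishes_shift 1) => /(_ e e0).
  by apply: filterS => n; rewrite addn1.
- rewrite -[psi^-1]ger0_norm ?invr_ge0 ?(ltW psi0) // -enormZ.
  rewrite (le_trans _ (enormD _ _)) // (gen_z hS (ltn0Sn n.+1)) /=.
  rewrite le_eqVlt; apply/orP; left; apply/eqP; congr enorm.
  by apply/rowP => i; rewrite !mxE; field; rewrite gt_eqF.
Qed.

Lemma vanishes_x_znext : vanishes (fun n => enorm (x n.+1 - z n.+2)).
Proof.
have /andP[psi1 _] := ap_psi hP; have psi0 := lt_trans ltr01 psi1.
have k : 0 <= psi^-1 by rewrite invr_ge0 ltW.
apply: vanishes_le (vanishesZ _ _ k vanishes_x_z) _; apply: nearW => n.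
rewrite -[psi^-1]ger0_norm // -enormZ (gen_z hS (ltn0Sn n.+1)) /=.
rewrite le_eqVlt; apply/orP; left; apply/eqP; congr enorm.
by apply/rowP => i; rewrite !mxE; field; rewrite gt_eqF.
Qed.

Lemma vanishes_x_md : vanishes (fun n => enorm (x n.+1 - x_md P S n.+1)).
Proof.
have /andP[a0 a1] := ap_a hP; have [dxV _] := vanishes_dx_r.
have a2 : 0 <= 1 - a by rewrite subr_ge0 ltW.
apply: vanishes_le (vanishesD _ _ (vanishesZ _ _ (ltW a0) dxV)
  (vanishesZ _ _ a2 vanishes_x_z)) _; apply: nearW => n.
rewrite -[X in X * dx n]gtr0_norm // -[X in _ + X * _]ger0_norm // -!enormZ.
rewrite (le_trans _ (enormD _ _)) // /x_md /= le_eqVlt; apply/orP; left; apply/eqP.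
by congr enorm; apply/rowP => i; rewrite !mxE; ring.
Qed.

(** The potential bounds x and [zb]; its weight on y is b, possibly zero, so y is reached through y
    - [zb]. *)
Lemma iterates_bounded : exists K : R,
  \forall n \near \oo, enorm (x n) <= K /\ enorm (y n) <= K.
Proof.
have [[u v] uv _] := adm_saddle hD.
have /andP[a0 a1] := ap_a hP; have beta0 := ap_beta hP.
have bi : 0 < beta^-1 by rewrite invr_gt0.
pose C := potential u v 0.
have lC n : (M <= n)%N -> a * dot (x n.+1 - u) (x n.+1 - u) +
    beta^-1 * dot (zb n.+1 - v) (zb n.+1 - v) <= C.
  move=> Mn; apply: le_trans (lyap_ge u v n) _; rewrite -{1}(subnK Mn).
  exact: le_trans (potential_ge u v _) (potential_nonincreasing u v 0 _ uv _).
have Kx n : (M <= n)%N -> enorm (x n.+1 - u) <= Num.sqrt (C / a).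
  move=> /lC le; apply: ler_wsqrtr; rewrite ler_pdivlMr // mulrC.
  by apply: le_trans le; rewrite lerDl mulr_ge0 ?dot_ge0 // ltW.
have Ky n : (M <= n)%N -> enorm (zb n.+1 - v) <= Num.sqrt (C / beta^-1).
  move=> /lC le; apply: ler_wsqrtr; rewrite ler_pdivlMr // mulrC.
  by apply: le_trans le; rewrite lerDr mulr_ge0 ?dot_ge0 // ltW.
have [N _ hN] := vanishes_y_zb 1 ltr01.
exists (Num.sqrt (C / a) + enorm u + (1 + (Num.sqrt (C / beta^-1) + enorm v))).
exists (maxn M.+1 N) => // -[|n] /=; rewrite geq_max // => /andP[Mn Nn].
have s1 := sqrtr_ge0 (C / a); have s2 := sqrtr_ge0 (C / beta^-1).
have u0 := enorm_ge0 u; have v0 := enorm_ge0 v.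
have := hN _ Nn; rewrite /= => yz; split.
  have := enorm_sub (x n.+1) u; have := Kx n Mn; lra.
have := enorm_sub (y n.+1) (zb n.+1); have := enorm_sub (zb n.+1) v; have := Ky n Mn; lra.
Qed.

(** * Lower bound on the step sizes *)

Lemma ls_r_lower : exists2 k : R, 0 < k & forall n v,
  omega1 P * delta n * dx n ^+ 2 + k * enorm (v - y n) ^+ 2 <= ls_r P S n.+1 v.
Proof.
have /andP[b0 b1] := ap_b hP; have beta0 := ap_beta hP.
have bi : 0 < beta^-1 by rewrite invr_gt0.
(* For b = 0, [zb n.+1] is [y n] and the last term of [ls_r] gives the bound; otherwise the middle
   term does. *)
have [bz|bn0] := eqVneq b 0.
  exists beta^-1 => // n v; rewrite /ls_r /= (gen_zb hS) // bz.
  by rewrite subr0 addr0 mulr1 mulr1 mul0r mul0r addr0 scale1r scale0r addr0.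
have bp : 0 < b by rewrite lt_neqAle eq_sym bn0.
exists (b / beta) => [|n v]; first by rewrite divr_gt0.
rewrite /ls_r /= lerDl; apply: mulr_ge0 (sqr_ge0 _).
apply: mulr_ge0; last by rewrite addr_ge0.
by apply: mulr_ge0; rewrite ?subr_ge0 ltW.
Qed.

(** Concavity at [v] turns the linearization error into a gradient difference, so a Lipschitz
    gradient makes it quadratic. *)
Lemma ls_Phi_le n v : B v ->
  ls_Phi D S n.+1 v <=
  enorm (grady (x n.+1) v - grady (x n.+1) (y n)) * enorm (v - y n).
Proof.
move=> vB.
have := sd_Phi_grady D hD _ _ _ (x_dom n.+1) vB (y_dom n).
rewrite -(opprB v (y n)) dotNr => le.
have := dot_le_enorm (- (grady (x n.+1) v - grady (x n.+1) (y n))) (v - y n).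
rewrite enormN dotNl dotDl dotNl /ls_Phi /=; lra.
Qed.

Lemma ls_accept_small (K : R) : exists2 t0 : R, 0 < t0 & forall n t v,
  enorm (x n.+2) <= K -> enorm (x n.+1) <= K -> enorm (y n.+1) <= K -> enorm v <= K ->
  (M <= n.+1)%N -> B v -> 0 < t <= t0 -> ls_accept D P S n.+2 t v.
Proof.
have [Lxx [Lyy [Lxy [Lxx0 Lyy0 Lxy0 L]]]] :=
  adm_lipschitz hD (bounded_enorm (n:=q) K) (bounded_enorm (n:=p) K).
have [k k0 rk] := ls_r_lower.
have /andP[a0 a1] := ap_a hP; have /andP[nu0 nu1] := ap_nu hP.
have xi0 := ap_xi hP; have om0 := ap_omega1 hP; have tm0 := ap_taumax hP.
have c0 : 0 < (1 - a) * xi by rewrite mulr_gt0 // subr_gt0.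
pose k1 := 2 * Lxx ^+ 2 / ((1 - a) * xi).
pose k2 := 2 * Lxy ^+ 2 / ((1 - a) * xi) * ntaumax P + 2 * Lyy.
have ci : 0 <= ((1 - a) * xi)^-1 by rewrite invr_ge0 ltW.
have k10 : 0 <= k1 := mulr_ge0 (mulr_ge0 (ler0n R 2) (sqr_ge0 _)) ci.
have k20 : 0 <= k2.
  exact: addr_ge0 (mulr_ge0 (mulr_ge0 (mulr_ge0 (ler0n R 2) (sqr_ge0 _)) ci) (ltW tm0))
    (mulr_ge0 (ler0n R 2) Lyy0).
(* Thresholds [d1] and [d2] make the squared increments of x and of y fit separately into nu times
   [ls_r]. *)
have e10 : 0 < nu * omega1 P / ntaumax P by rewrite divr_gt0 ?mulr_gt0.
have [d1 d10 d1e] := scaler_small _ _ k10 e10.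
have [d2 d20 d2e] := scaler_small _ _ k20 (mulr_gt0 nu0 k0).
exists (Num.min d1 d2); first by rewrite lt_min d10.
move=> n t v x2 x1 y1 vK Mn vB /andP[t0]; rewrite le_min => /andP[td1 td2].
have xA := x_dom; have yB := y_dom.
have [_ L1] := L (x n.+2) (x n.+1) v (y n.+1)
  (conj x2 (xA _)) (conj x1 (xA _)) (conj vK vB) (conj y1 (yB _)).
have [L2 _] := L (x n.+2) (x n.+2) v (y n.+1)
  (conj x2 (xA _)) (conj x2 (xA _)) (conj vK vB) (conj y1 (yB _)).
have Ph := ls_Phi_le n.+1 v vB.
set e := enorm (v - y n.+1) in L1 L2 Ph.
set d := dx n.+1 in L1.
have e0 : 0 <= e := enorm_ge0 _.
have d0 : 0 <= d := enorm_ge0 _.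
have Ph2 : ls_Phi D S n.+2 v <= Lyy * e ^+ 2.
  by rewrite (le_trans Ph) // expr2 mulrA ler_wpM2r.
have th : enorm (ls_theta D S n.+2 v) ^+ 2 <= 2 * Lxx ^+ 2 * d ^+ 2 + 2 * Lxy ^+ 2 * e ^+ 2.
  have : enorm (ls_theta D S n.+2 v) ^+ 2 <= (Lxx * d + Lxy * e) ^+ 2.
    by rewrite ler_sqr ?nnegrE ?enorm_ge0 // addr_ge0 // mulr_ge0 // ltW.
  have := sqr_ge0 (Lxx * d - Lxy * e); lra.
have t1 := tau_gt0 n.+1.
have tm := tau_le_max.
(* The weight [delta n.+1] in [ls_r] might be small, but only in proportion to [tau n.+1], which
   also multiplies the theta term. The index n + 2 ensures that this delta is a ratio of steps and
   not the initial value. *)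
have dl : tau n.+1 / ntaumax P <= delta n.+1.
  rewrite (gen_delta hS) //= ler_pM2l // lef_pV2 ?posrE //.
  exact: tau_gt0 n.
have cge : 0 <= ls_c P S n.+2.
  by rewrite -(subnK Mn); exact: ls_c_ge0 _.
have rv := rk n.+1 v; rewrite -/e -/d in rv.
have s0 : 0 <= t * tau n.+1 / ((1 - a) * xi) := mulr_ge0 (mulr_ge0 (ltW t0) (ltW t1)) ci.
have h1 : t * tau n.+1 / ((1 - a) * xi) * (2 * Lxx ^+ 2 * d ^+ 2) <=
    nu * (omega1 P * delta n.+1 * d ^+ 2).
  have -> : t * tau n.+1 / ((1 - a) * xi) * (2 * Lxx ^+ 2 * d ^+ 2) =
     k1 * t * tau n.+1 * d ^+ 2 by rewrite /k1; ring.
  have -> : nu * (omega1 P * delta n.+1 * d ^+ 2) = nu * omega1 P * delta n.+1 * d ^+ 2.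
    by ring.
  rewrite ler_wpM2r ?sqr_ge0 //.
  apply: (@le_trans _ _ (nu * omega1 P * (tau n.+1 / ntaumax P))).
    have -> : nu * omega1 P * (tau n.+1 / ntaumax P) =
      nu * omega1 P / ntaumax P * tau n.+1 by ring.
    by rewrite ler_wpM2r ?(ltW t1) // (le_trans _ d1e) // ler_wpM2l.
  by rewrite ler_wpM2l // ltW // mulr_gt0.
have h2 : t * tau n.+1 / ((1 - a) * xi) * (2 * Lxy ^+ 2 * e ^+ 2) + 2 * t * (Lyy * e ^+ 2) <=
    nu * (k * e ^+ 2).
  apply: (@le_trans _ _ (k2 * t * e ^+ 2)).
    have -> : t * tau n.+1 / ((1 - a) * xi) * (2 * Lxy ^+ 2 * e ^+ 2) + 2 * t * (Lyy * e ^+ 2) =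
      (2 * Lxy ^+ 2 / ((1 - a) * xi) * tau n.+1 + 2 * Lyy) * t * e ^+ 2 by ring.
    rewrite ler_wpM2r ?sqr_ge0 // ler_wpM2r ?(ltW t0) // lerD2r ler_wpM2l ?tm //.
    exact: mulr_ge0 (mulr_ge0 (ler0n R 2) (sqr_ge0 _)) ci.
  by rewrite mulrA ler_wpM2r ?sqr_ge0 // (le_trans _ d2e) // ler_wpM2l.
have h3 := ler_wpM2l s0 th.
have h4 := ler_wpM2l (mulr_ge0 (ler0n R 2) (ltW t0)) Ph2.
have h5 := ler_wpM2l (ltW nu0) rv.
have h6 : 0 <= (1 - nu) * ls_c P S n.+2 by rewrite mulr_ge0 // subr_ge0 ltW.
rewrite /ls_accept /=; lra.
Qed.

(** Rejection of a step is stated for every trial point, so it has content only when one exists. *)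
Lemma y_trial_exists n t : 0 < t -> y_trial D P S n t !=set0.
Proof.
move=> t0; have [fP _ _] := adm_f hD.
apply: prox_exists; last by rewrite mulr_gt0 // (ap_beta hP).
- exact: sd_fs_gtNy.
- exact: dom_fs_neq0.
- exact: sd_fs_closed.
- exact: conjugate_affine_minorant.
Qed.

Lemma tau_lower_bound : exists2 t : R, 0 < t & \forall n \near \oo, t <= tau n.
Proof.
have [K [N _ hK]] := iterates_bounded.
have [N' _ hN'] := vanishes_y_md 1 ltr01.
have /andP[mu0 mu1] := ap_mu hP; have /andP[phi1 _] := ap_phi hP.
have mi0 : 0 < mu^-1 by rewrite invr_gt0.
(* The radius holds the rejected point: it is within 1 / mu of [y_md], which is within 1 of the
   accepted iterate, of norm at most K. *)
have [t0 t00 acc] := ls_accept_small (K + 1 + mu^-1).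
pose N0 := maxn M (maxn N N').
(* Without backtracking the step does not decrease, as phi > 1; with backtracking the last rejected
   value exceeds [t0]. *)
have step n : (N0 <= n)%N -> Num.min (tau n.+1) (mu * t0) <= tau n.+2.
  rewrite !geq_max => /and3P[Mn Nn N'n].
  have [i [tE yT _ rej]] := gen_linesearch hS (ltn0Sn n.+1).
  case: i tE rej => [|i] tE rej.
    rewrite tE expr0 mulr1 /tau_start ge_min; apply/orP; left.
    rewrite le_min (tau_le_max) andbT /=.
    by rewrite ler_peMl ?(ltW phi1) // ltW // (tau_gt0).
  set t := tau_start P S n.+2 * mu ^+ i.
  have tpos : 0 < t by rewrite mulr_gt0 ?exprn_gt0 // (tau_start_gt0).
  have tauE : tau n.+2 = mu * t by rewrite tE exprS /t; ring.
  have [v vT] := y_trial_exists n.+2 t tpos.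
  have := rej i v (ltnSn i) vT; rewrite -/t => nacc.
  clearbody t; rewrite ge_min; apply/orP; right; rewrite tauE ler_pM2l // leNgt.
  apply: contra nacc => tt0.
  have beta0 := ap_beta hP.
  have vB : B v.
    by have [] := proxE _ _ _ _ (sd_fs_gtNy D hD) dom_fs_neq0 vT.
  have ratio : enorm (v - y_md P S n.+2) <= mu^-1.
    have := prox_step_ratio fs (beta * tau n.+2) (beta * t) (y_md P S n.+2)
      (grady (x n.+2) (y n.+1)) (y n.+2) v (sd_fs_gtNy D hD) (sd_fs_convex D hD)
      dom_fs_neq0 _ yT vT.
    rewrite mulr_gt0 ?(tau_gt0) // ler_pM2l // tauE ler_piMl ?(ltW mu1) ?(ltW tpos) //.
    move=> /(_ isT); rewrite -!mulrA ler_pM2l // [mu * _]mulrCA ler_pM2l //.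
    move=> le; rewrite -(ler_pM2l mu0) mulfV ?gt_eqF // (le_trans le) //.
    by apply/ltW; apply: (hN' n.+1) => /=; rewrite ltnW.
  have [x2 y2] := hK n.+2 (leq_trans Nn (leqW (leqnSn n))).
  have [x1 y1] := hK n.+1 (leq_trans Nn (leqnSn n)).
  have ymd : enorm (y n.+2 - y_md P S n.+2) < 1 by apply: (hN' n.+1) => /=; rewrite ltnW.
  have KK m (w : 'rV[R]_m) : enorm w <= K -> enorm w <= K + 1 + mu^-1.
    by move=> le; rewrite (le_trans le) // -addrA lerDl addr_ge0 // ltW.
  apply: acc (KK _ _ x2) (KK _ _ x1) (KK _ _ y1) _ _ vB _; last by rewrite tpos ltW.
  - have := enorm_sub v (y_md P S n.+2); have := enorm_sub (y_md P S n.+2) (y n.+2).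
    rewrite (enormB (y_md P S n.+2)); lra.
  - by rewrite ltnW.
have tl n : (N0 < n)%N -> Num.min (tau N0.+1) (mu * t0) <= tau n.
  elim: n => // n IH; rewrite ltnS leq_eqVlt => /orP[/eqP <-|lt].
    by rewrite ge_min lexx.
  case: n IH lt => // n IH lt; apply: le_trans (step n lt).
  by rewrite le_min IH // ge_min lexx orbT.
exists (Num.min (tau N0.+1) (mu * t0)).
  by rewrite lt_min (tau_gt0) mulr_gt0.
by exists N0.+1.
Qed.

(** * Cluster points and limiting inequalities *)

Lemma joint_cluster_point : exists xs ys, forall (e : R) (Q : nat -> Prop), 0 < e ->
  (\forall n \near \oo, Q n) -> exists n, [/\ Q n, enorm (x n - xs) < e & enorm (y n - ys) < e].
Proof.
have [K [N _ hK]] := iterates_bounded.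
have rowE m1 m2 (u : 'rV[R]_m1) (v : 'rV[R]_m2) :
    dot (row_mx u v) (row_mx u v) = dot u u + dot v v.
  rewrite /dot big_split_ord /=; congr (_ + _); apply: eq_bigr => i _.
    by rewrite row_mxEl.
  by rewrite row_mxEr.
(* Concatenation makes x and y close to their cluster points at the same index. *)
have [n|w hw] := bounded_cluster_point (fun n => row_mx (x (n + N)%N) (y (n + N)%N)) (K + K).
  have [xK yK] := hK (n + N)%N (leq_addl _ _).
  have x0 := enorm_ge0 (x (n + N)%N); have y0 := enorm_ge0 (y (n + N)%N).
  rewrite ler_enorm; last by lra.
  rewrite rowE -!enorm_sqr; nra.
exists (lsubmx w), (rsubmx w) => e Q e0 [N' _ hN'].
have [n Nn] := hw e e0 N'; rewrite -[w in _ - w]hsubmxK opp_row_mx add_row_mx => ne.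
exists (n + N)%N; split.
- by apply: hN'; rewrite /= (leq_trans Nn) // leq_addr.
- by apply: le_lt_trans ne; apply: ler_wsqrtr; rewrite rowE lerDl dot_ge0.
- by apply: le_lt_trans ne; apply: ler_wsqrtr; rewrite rowE lerDr dot_ge0.
Qed.

Lemma gradx_bounded : exists2 C : R, 0 <= C &
  \forall n \near \oo, enorm (gradx (x n) (y n)) <= C.
Proof.
have [K [N _ hK]] := iterates_bounded.
have [Lxx [Lyy [Lxy [Lxx0 Lyy0 Lxy0 L]]]] :=
  adm_lipschitz hD (bounded_enorm (n:=q) K) (bounded_enorm (n:=p) K).
have [xN yN] := hK N (leqnn N).
have K0 : 0 <= K := le_trans (enorm_ge0 _) xN.
have xA := x_dom; have yB := y_dom.
exists (Lxx * (K + K) + Lxy * (K + K) + enorm (gradx (x N) (y N))).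
  by rewrite addr_ge0 ?enorm_ge0 // addr_ge0 // mulr_ge0 ?addr_ge0 // ltW.
exists N => // n /= /hK [xn yn].
have [_ le] := L (x n) (x N) (y n) (y N)
  (conj xn (xA _)) (conj xN (xA _)) (conj yn (yB _)) (conj yN (yB _)).
apply: le_trans (enorm_sub _ (gradx (x N) (y N))) _; rewrite lerD2r (le_trans le) //.
apply: lerD; (apply: ler_wpM2l; first by rewrite ?(ltW Lxy0)).
  by rewrite (le_trans (enormD _ _)) // enormN lerD.
by rewrite (le_trans (enormD _ _)) // enormN lerD.
Qed.

(** The lower bound on the steps makes the prox residual vanish after division by [tau n]. The
    gradient form bounds g along the iterates by [gradx_bounded] alone, before the cluster point is
    known to lie in its domain. *)
Lemma x_limit_ineq_grad u (e : R) : A u -> 0 < e -> \forall n \near \oo,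
  G (x n.+1) <= G u + dot (gradx (x n) (y n)) (u - x n) + e.
Proof.
move=> uA e0.
have [K KN] := iterates_bounded.
have [t t0 tN] := tau_lower_bound.
have [C C0 CN] := gradx_bounded.
have [dxV _] := vanishes_dx_r.
have mdV := vanishes_x_md.
have ti : 0 <= t^-1 by rewrite invr_ge0 ltW.
have K0 : 0 <= `|K| + 1 + enorm u by rewrite !addr_ge0 ?enorm_ge0.
have V := vanishesD _ _ (vanishesZ _ _ (mulr_ge0 ti K0) mdV) (vanishesZ _ _ C0 dxV).
near=> n.
have [xK _] : enorm (x n) <= K /\ enorm (y n) <= K by near: n.
have tn : t <= tau n by near: n.
have gn : enorm (gradx (x n) (y n)) <= C by near: n.
have d1 : dx n < 1 by near: n; exact: dxV.
have Vn : t^-1 * (`|K| + 1 + enorm u) * enorm (x n.+1 - x_md P S n.+1) + C * dx n < e.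
  by near: n; exact: V.
have tau0 := tau_gt0 n.
have := x_step n u uA.
rewrite -ler_pdivlMl // mulrDr mulKf ?gt_eqF // => le.
have ux : enorm (u - x n.+1) <= `|K| + 1 + enorm u.
  have := enormD u (- x n.+1); rewrite enormN; have := enorm_sub (x n.+1) (x n).
  have := ler_norm K; lra.
have m0 : 0 <= enorm (x n.+1 - x_md P S n.+1) := enorm_ge0 _.
have le1 : (tau n)^-1 * dot (x n.+1 - x_md P S n.+1) (u - x n.+1) <=
    t^-1 * (`|K| + 1 + enorm u) * enorm (x n.+1 - x_md P S n.+1).
  apply: (@le_trans _ _ ((tau n)^-1 * ((`|K| + 1 + enorm u) * enorm (x n.+1 - x_md P S n.+1)))).
    rewrite ler_wpM2l ?invr_ge0 ?(ltW tau0) // (le_trans (dot_le_enorm _ _)) //.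
    by rewrite mulrC ler_wpM2r.
  by rewrite mulrA ler_wpM2r // ler_wpM2r // lef_pV2.
have le2 : dot (gradx (x n) (y n)) (x n - x n.+1) <= C * dx n.
  by rewrite (le_trans (dot_le_enorm _ _)) // enormB ler_wpM2r ?enorm_ge0.
move: le; have -> : u - x n.+1 = (u - x n) + (x n - x n.+1) by rewrite addrA subrK.
rewrite [dot (gradx _ _) _]dotDr; rewrite -[u - x n + _]addrA; rewrite [- x n + _]addrA addNr add0r.
rewrite /=; lra.
Unshelve. all: by end_near. Qed.

Lemma x_limit_ineq u (e : R) : A u -> 0 < e -> \forall n \near \oo,
  G (x n.+1) + Phi (x n) (y n) <= G u + Phi u (y n) + e.
Proof.
move=> uA e0; near=> n.
have : G (x n.+1) <= G u + dot (gradx (x n) (y n)) (u - x n) + e.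
  by near: n; exact: x_limit_ineq_grad.
have := sd_Phi_gradx D hD _ _ _ (x_dom n) uA (y_dom n).
lra.
Unshelve. all: by end_near. Qed.

Lemma y_limit_ineq v (e : R) : B v -> 0 < e -> \forall n \near \oo,
  H (y n) + Phi (x n) v <= H v + Phi (x n) (y n) + e.
Proof.
move=> vB e0; apply: (near_infty_shift 1).
have [K [N _ hK]] := iterates_bounded.
have KN : \forall n \near \oo, enorm (x n) <= K /\ enorm (y n) <= K by exists N.
have [Lxx [Lyy [Lxy [Lxx0 Lyy0 Lxy0 L]]]] :=
  adm_lipschitz hD (bounded_enorm (n:=q) K) (bounded_enorm (n:=p) K).
have [t t0 [N' _ tN]] := tau_lower_bound.
have mdV := vanishes_y_md.
have dyV := vanishes_dy.
have beta0 := ap_beta hP.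
have ti : 0 <= t^-1 by rewrite invr_ge0 ltW.
have bi : 0 <= beta^-1 by rewrite invr_ge0 ltW.
have K0 : 0 <= `|K| + enorm v by rewrite !addr_ge0 ?enorm_ge0.
have V := vanishesD _ _ (vanishesZ _ _ (mulr_ge0 (mulr_ge0 ti bi) K0) mdV) (vanishesZ _ _ Lyy0 dyV).
near=> n; rewrite addn1.
have Nn : (N <= n)%N by near: n; exists N.
have Nn' : (N' <= n)%N by near: n; exists N'.
have [x1 y1] := hK n.+1 (leqW Nn); have [_ y0] := hK n Nn.
have tn : t <= tau n.+1 by apply: tN; exact: leqW.
have d1 : enorm (y n.+1 - y n) < 1 by near: n; exact: dyV.
have Vn : t^-1 * beta^-1 * (`|K| + enorm v) * enorm (y n.+1 - y_md P S n.+1)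
   + Lyy * enorm (y n.+1 - y n) < e by near: n; exact: V.
have tau0 := tau_gt0 n.+1.
have xA := x_dom; have yB := y_dom.
have := y_step_Phi n v vB.
rewrite -ler_pdivlMl // mulrDr mulKf ?gt_eqF // => le.
have vy : enorm (v - y n.+1) <= `|K| + enorm v.
  have := enormD v (- y n.+1); rewrite enormN; have := ler_norm K; lra.
have m0 : 0 <= enorm (y n.+1 - y_md P S n.+1) := enorm_ge0 _.
have le1 : (tau n.+1)^-1 * (beta^-1 * dot (y n.+1 - y_md P S n.+1) (v - y n.+1)) <=
    t^-1 * beta^-1 * (`|K| + enorm v) * enorm (y n.+1 - y_md P S n.+1).
  rewrite mulrA -mulrA.
  apply: (@le_trans _ _ ((tau n.+1)^-1 *
      (beta^-1 * ((`|K| + enorm v) * enorm (y n.+1 - y_md P S n.+1))))).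
    rewrite ler_wpM2l ?invr_ge0 ?(ltW tau0) // ler_wpM2l //.
    by rewrite (le_trans (dot_le_enorm _ _)) // mulrC ler_wpM2r.
  have -> : t^-1 * beta^-1 * (`|K| + enorm v) * enorm (y n.+1 - y_md P S n.+1) =
    t^-1 * (beta^-1 * ((`|K| + enorm v) * enorm (y n.+1 - y_md P S n.+1))) by ring.
  by rewrite ler_wpM2r ?lef_pV2 // mulr_ge0 // mulr_ge0.
have [L1 _] := L (x n.+1) (x n.+1) (y n.+1) (y n)
  (conj x1 (xA _)) (conj x1 (xA _)) (conj y1 (yB _)) (conj y0 (yB _)).
(* Increments below 1 allow the square to be replaced by the first power. *)
have le2 : ls_Phi D S n.+1 (y n.+1) <= Lyy * enorm (y n.+1 - y n).
  apply: (le_trans (ls_Phi_le n _ (yB n.+1))).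
  have d0 := enorm_ge0 (y n.+1 - y n).
  apply: (@le_trans _ _ (Lyy * enorm (y n.+1 - y n) * 1)); last by rewrite mulr1.
  by apply: ler_pM => //; [exact: enorm_ge0|exact: ltW].
rewrite /= in le *; lra.
Unshelve. all: by end_near. Qed.

Lemma vanishes_window : vanishes (fun m => window m).
Proof.
have [_ rV] := vanishes_dx_r.
apply: vanishes_sum => j; apply: vanishesZ => //.
have := rV; rewrite -(vanishes_shift j.+1) => V e /V.
by apply: filterS => n; rewrite addnS addSn.
Qed.

Lemma near_dx (e : R) : 0 < e -> \forall n \near \oo, dx n < e.
Proof. by have [V _] := vanishes_dx_r; exact: V. Qed.

(** * Optimality of the cluster point and convergence *)

Section ClusterPoint.
Context (xs : 'rV[R]_q) (ys : 'rV[R]_p).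
Context (cluster : forall (e : R) (Q : nat -> Prop), 0 < e ->
  (\forall n \near \oo, Q n) ->
  exists n, [/\ Q n, enorm (x n - xs) < e & enorm (y n - ys) < e]).

Lemma cluster_next (e : R) : 0 < e -> forall n, dx n < e / 2 -> enorm (x n - xs) < e / 2 ->
  enorm (x n.+1 - xs) < e.
Proof.
move=> e0 n d1 d2; have := enormD (x n.+1 - x n) (x n - xs).
rewrite addrA subrK; lra.
Qed.

Lemma cluster_dom_x : A xs.
Proof.
have [[u v] [/= uA vB _] _] := adm_saddle hD.
have [K KN] := iterates_bounded.
have [C C0 CN] := gradx_bounded.
have [] := sd_g_closed D hD xs (G u + C * (enorm u + `|K|) + 1); last by [].
move=> e e0; have e2 : 0 < e / 2 by rewrite divr_gt0.
have [|n [[dn gn]]] := cluster (e / 2) (fun n => dx n < e / 2 /\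
  G (x n.+1) <= G u + C * (enorm u + `|K|) + 1) e2 _.
  near=> n; split; first by near: n; exact: near_dx.
  have : G (x n.+1) <= G u + dot (gradx (x n) (y n)) (u - x n) + 1.
    by near: n; exact: x_limit_ineq_grad.
  have [xK _] : enorm (x n) <= K /\ enorm (y n) <= K by near: n.
  have gC : enorm (gradx (x n) (y n)) <= C by near: n.
  have := dot_le_enorm (gradx (x n) (y n)) (u - x n).
  have h1 : enorm (u - x n) <= enorm u + `|K|.
    by rewrite (le_trans (enormD _ _)) // enormN lerD2l (le_trans xK) // ler_norm.
  have := ler_pM (enorm_ge0 _) (enorm_ge0 _) gC h1; lra.
move=> xn yn; exists (x n.+1); split.
- exact: x_dom _.
- exact: cluster_next.
- by rewrite (le_trans gn) // lerDl ltW.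
Unshelve. all: by end_near. Qed.

Lemma cluster_dom_y : B ys.
Proof.
have [[u v] [/= uA vB _] _] := adm_saddle hD.
have [K KN] := iterates_bounded.
have [C C0 CN] := gradx_bounded.
(* [Phi (x n) (y n)] is bounded through [Phi u (y n)], then through the gradient in y at (u, v);
   [Phi (x n) v] is bounded below by the gradient in x at (u, v). *)
pose T := H v + (Phi u v + enorm (grady u v) * (`|K| + enorm v)) + C * (enorm u + `|K|)
  - (Phi u v - enorm (gradx u v) * (`|K| + enorm u)) + 1.
have [] := sd_fs_closed D hD ys T; last by [].
move=> e e0.
have [|n [hn _ yn]] := cluster e (fun n => H (y n) <= T) e0 _.
  near=> n.
  have : H (y n) + Phi (x n) v <= H v + Phi (x n) (y n) + 1 by near: n; exact: y_limit_ineq.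
  have [xK yK] : enorm (x n) <= K /\ enorm (y n) <= K by near: n.
  have gC : enorm (gradx (x n) (y n)) <= C by near: n.
  have KK := ler_norm K.
  have xA := x_dom n; have yB := y_dom n.
  have h1 := sd_Phi_gradx D hD _ _ _ xA uA yB.
  have h2 := sd_Phi_grady D hD _ _ _ uA vB yB.
  have h3 := sd_Phi_gradx D hD _ _ _ uA xA vB.
  have ux : enorm (u - x n) <= enorm u + `|K|.
    by rewrite (le_trans (enormD _ _)) // enormN lerD2l (le_trans xK).
  have yv : enorm (y n - v) <= `|K| + enorm v.
    by rewrite (le_trans (enormD _ _)) // enormN lerD2r (le_trans yK).
  have xu : enorm (- (x n - u)) <= `|K| + enorm u.
    by rewrite enormN (le_trans (enormD _ _)) // enormN lerD2r (le_trans xK).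
  have g1 := dot_le_enorm (- gradx (x n) (y n)) (u - x n).
  have g2 := dot_le_enorm (grady u v) (y n - v).
  have g3 := dot_le_enorm (gradx u v) (- (x n - u)).
  rewrite dotNl enormN in g1; rewrite dotNr in g3.
  have := ler_pM (enorm_ge0 _) (enorm_ge0 _) gC ux.
  have := ler_wpM2l (enorm_ge0 (grady u v)) yv.
  have := ler_wpM2l (enorm_ge0 (gradx u v)) xu.
  rewrite /T; lra.
exists (y n); split=> //; first exact: y_dom _.
by rewrite (le_trans hn) // lerDl ltW.
Unshelve. all: by end_near. Qed.

Lemma cluster_Phi (u : 'rV[R]_q) (v : 'rV[R]_p) (e : R) : A u -> B v -> 0 < e ->
  exists2 d : R, 0 < d & forall n, enorm (x n - xs) < d -> enorm (y n - ys) < d ->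
    [/\ `|Phi (x n) (y n) - Phi xs ys| < e, `|Phi u (y n) - Phi u ys| < e &
        `|Phi (x n) v - Phi xs v| < e].
Proof.
move=> uA vB e0.
have xA := x_dom; have yB := y_dom.
have [d1 d10 h1] := sd_Phi_continuous D hD _ _ _ cluster_dom_x cluster_dom_y e0.
have [d2 d20 h2] := sd_Phi_continuous D hD _ _ _ uA cluster_dom_y e0.
have [d3 d30 h3] := sd_Phi_continuous D hD _ _ _ cluster_dom_x vB e0.
exists (Num.min d1 (Num.min d2 d3)); first by rewrite !lt_min d10 d20.
move=> n; rewrite !lt_min => /and3P[x1 x2 x3] /and3P[y1 y2 y3]; split.
- exact: h1.
- by apply: h2 => //; rewrite subrr enorm0.
- by apply: h3 => //; rewrite subrr enorm0.
Qed.

Lemma cluster_saddle : saddle_points D (xs, ys).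
Proof.
have xsA := cluster_dom_x; have ysB := cluster_dom_y.
split=> //= u v uA vB.
(* Closedness is applied to [x n.+1], since g is bounded there while [Phi] is taken at index n. One
   third of e comes from the limiting inequality and two from continuity of [Phi]. *)
have hx : G xs <= G u + Phi u ys - Phi xs ys.
  have [] := sd_g_closed D hD xs (G u + Phi u ys - Phi xs ys); last by [].
  move=> e e0; have e3 : 0 < e / 3 by rewrite divr_gt0.
  have e2 : 0 < e / 2 by rewrite divr_gt0.
  have [d d0 hd] := cluster_Phi u v (e / 3) uA vB e3.
  have m0 : 0 < Num.min d (e / 2) by rewrite lt_min d0.
  have [|n [[dn gn]]] := cluster _ (fun n => dx n < e / 2 /\
    G (x n.+1) + Phi (x n) (y n) <= G u + Phi u (y n) + e / 3) m0 _.
    near=> n; split; first by near: n; exact: near_dx.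
    by near: n; exact: x_limit_ineq.
  rewrite !lt_min => /andP[xd xe] /andP[yd ye].
  have [] := hd n xd yd; rewrite !ltr_norml => /andP[p1 p2] /andP[p3 p4] _.
  exists (x n.+1); split; [exact: x_dom _|exact: cluster_next|].
  lra.
have hy : H ys <= H v + Phi xs ys - Phi xs v.
  have [] := sd_fs_closed D hD ys (H v + Phi xs ys - Phi xs v); last by [].
  move=> e e0; have e3 : 0 < e / 3 by rewrite divr_gt0.
  have [d d0 hd] := cluster_Phi u v (e / 3) uA vB e3.
  have m0 : 0 < Num.min d e by rewrite lt_min d0.
  have [n [gn]] := cluster _ (fun n =>
    H (y n) + Phi (x n) v <= H v + Phi (x n) (y n) + e / 3) m0 (y_limit_ineq v _ vB e3).
  rewrite !lt_min => /andP[xd xe] /andP[yd ye].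
  have [] := hd n xd yd; rewrite !ltr_norml => /andP[p1 p2] _ /andP[p3 p4].
  exists (y n); split=> //; first exact: y_dom _.
  lra.
rewrite !(lagrangian_fine D hD) // !lee_fin /=.
rewrite /= in hx hy; split; lra.
Unshelve. all: by end_near. Qed.

Lemma potential_small (e : R) : 0 < e -> exists m, potential xs ys m < e.
Proof.
move=> e0.
have /andP[a0 a1] := ap_a hP; have /andP[b0 b1] := ap_b hP.
have /andP[eta0 eta1] := ap_eta hP; have /andP[nu0 nu1] := ap_nu hP.
have beta0 := ap_beta hP; have om0 := ap_omega1 hP.
have /andP[phi1 _] := ap_phi hP.
have kap0 := lyap_coeff_gt0.
have bi : 0 <= beta^-1 by rewrite invr_ge0 ltW.
have e2 : 0 < e / 2 by rewrite divr_gt0.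
set kap := (1 - a) * (psi / (psi - 1)) in kap0 *.
(* The factors are squared distances in units of s: 2 for x, 3 for z, 1 for y, 2 for [zb] and 1 for
   the increment of x. They bound [lyap] by C s^2, and s <= 1 gives s^2 <= d. *)
pose C := a * 4 + kap * 9 + beta^-1 * (b * 1 + 4) + (a + omega1 P * nphi P) * 1.
have C0 : 0 <= C.
  have op : 0 <= a + omega1 P * nphi P.
    apply: addr_ge0 (ltW a0) (mulr_ge0 (ltW om0) _); exact/ltW/(lt_trans ltr01).
  have := mulr_ge0 bi b0; rewrite /C; lra.
have [d d0 dC] := scaler_small _ _ C0 e2.
pose s := Num.min d 1.
have s0 : 0 < s by rewrite lt_min d0 ltr01.
have s1 : s ^+ 2 <= d.
  have sd : s <= d by rewrite ge_min lexx.
  have s1 : s <= 1 by rewrite ge_min lexx orbT.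
  by rewrite expr2 (le_trans _ sd) // ler_piMl // ltW.
have w0 : 0 <= (1 - nu) * (eta / M%:R) by rewrite mulr_ge0 ?divr_ge0 // subr_ge0 ltW.
have [N _ hN] := vanishesZ _ _ w0 vanishes_window _ e2.
have [|n [[Nn dn zn zbn] xn yn]] := cluster s (fun n => [/\ (N + M <= n)%N,
    dx n < s, enorm (x n.+1 - z n.+2) < s & enorm (zb n.+1 - y n) < s]) s0 _.
  near=> n; split.
  - by near: n; exists (N + M)%N.
  - by near: n; exact: near_dx _ s0.
  - by near: n; exact: vanishes_x_znext _ s0.
  - by near: n; exact: vanishes_zb_y _ s0.
have Mn : (M <= n)%N by rewrite (leq_trans _ Nn) // leq_addl.
exists (n - M)%N; rewrite /potential subnK //.
have := hN (n - M)%N; rewrite /= leq_subRL // addnC => /(_ Nn) wn.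
have n0 : (0 < n)%N by rewrite (leq_trans (ap_M hP)).
have dphi : delta n <= nphi P by rewrite -(prednK n0) delta_le.
have bound m (w : 'rV[R]_m) (k : R) : 0 <= k -> enorm w <= k * s -> dot w w <= k ^+ 2 * s ^+ 2.
  by move=> k0; rewrite ler_enorm ?exprMn // mulr_ge0 // ltW.
have x1 : enorm (x n.+1 - xs) <= 2 * s.
  have := enormD (x n.+1 - x n) (x n - xs); rewrite addrA subrK; lra.
have z1 : enorm (z n.+2 - xs) <= 3 * s.
  have := enormD (z n.+2 - x n.+1) (x n.+1 - xs); rewrite addrA subrK.
  rewrite (enormB (z n.+2)); lra.
have zb1 : enorm (zb n.+1 - ys) <= 2 * s.
  have := enormD (zb n.+1 - y n) (y n - ys); rewrite addrA subrK; lra.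
have h1 := ler_wpM2l (ltW a0) (bound _ _ _ (ler0n R 2) x1).
have h2 := ler_wpM2l (ltW kap0) (bound _ _ _ (ler0n R 3) z1).
have y1 : enorm (y n - ys) <= 1 * s by rewrite mul1r ltW.
have h3 := ler_wpM2l bi (lerD (ler_wpM2l b0 (bound _ _ _ ler01 y1)) (bound _ _ _ (ler0n R 2) zb1)).
have d1 : dx n <= 1 * s by rewrite mul1r ltW.
have h4 : (a + omega1 P * delta n) * dot (x n.+1 - x n) (x n.+1 - x n) <=
    (a + omega1 P * nphi P) * (1 ^+ 2 * s ^+ 2).
  apply: ler_pM; rewrite ?dot_ge0 //.
  - have := mulr_ge0 (ltW om0) (ltW (delta_gt0 n)); lra.
  - by rewrite lerD2l ler_wpM2l // ltW.
  - exact: bound.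
have h5 := ler_wpM2l C0 s1.
rewrite /lyap -/kap; rewrite /C in h5 dC; lra.
Unshelve. all: by end_near. Qed.

(** The cluster point is itself an admissible target, so its potential is monotone and small
    somewhere, hence tends to 0; it controls x and [zb], and y follows [zb]. *)
Lemma cluster_limit : x n @[n --> \oo] --> xs /\ y n @[n --> \oo] --> ys.
Proof.
have sp := cluster_saddle.
have /andP[a0 a1] := ap_a hP; have beta0 := ap_beta hP.
have bi : 0 < beta^-1 by rewrite invr_gt0.
have PV : forall e, 0 < e -> \forall n \near \oo, potential xs ys n < e.
  move=> e /potential_small[m me]; exists m => // n /= mn.
  exact: le_lt_trans (potential_nonincreasing _ _ _ _ sp mn) me.
have LV m : a * dot (x (m + M).+1 - xs) (x (m + M).+1 - xs) +
    beta^-1 * dot (zb (m + M).+1 - ys) (zb (m + M).+1 - ys) <= potential xs ys m.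
  exact: le_trans (lyap_ge _ _ _) (potential_ge _ _ _).
have xV : vanishes (fun n => enorm (x n - xs)).
  apply/vanishes_sqr/(vanishes_shift M.+1 (fun n => enorm (x n - xs) ^+ 2)).
  have ai : 0 <= a^-1 by rewrite invr_ge0 ltW.
  apply: vanishes_le (vanishesZ _ _ ai PV) _; apply: nearW => m.
  rewrite -(ler_pM2l a0) mulVKf ?gt_eqF // enorm_sqr addnS (le_trans _ (LV m)) //.
  by rewrite lerDl mulr_ge0 ?dot_ge0 // ltW.
have zbV : vanishes (fun n => enorm (zb n - ys)).
  apply/vanishes_sqr/(vanishes_shift M.+1 (fun n => enorm (zb n - ys) ^+ 2)).
  apply: vanishes_le (vanishesZ _ _ (ltW beta0) PV) _; apply: nearW => m.
  rewrite -(ler_pM2l bi) mulKf ?gt_eqF // enorm_sqr addnS (le_trans _ (LV m)) //.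
  by rewrite lerDr mulr_ge0 ?dot_ge0 // ltW.
have yV : vanishes (fun n => enorm (y n - ys)).
  apply: vanishes_le (vanishesD _ _ (vanishes_y_zb) zbV) _.
  by apply: nearW => n; rewrite (le_trans _ (enormD _ _)) // addrA subrK.
have cv m (w : nat -> 'rV[R]_m) l : vanishes (fun n => enorm (w n - l)) ->
    w n @[n --> \oo] --> l.
  move=> V; apply: enorm_cvg; apply/cvgrPdist_lt => e /V; apply: filterS => n.
  by rewrite sub0r normrN ger0_norm // enorm_ge0.
by split; exact: cv.
Qed.

End ClusterPoint.

End NPDAL.

Theorem theorem1 (R : realType) (q p : nat)
    (D : saddle_data R q p) (hD : admissible_data D)
    (P : npdal_params R) (hP : admissible_params P)
    (S : iterates R q p) (hS : npdal_generated D P S) :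
  exists (xs : 'rV[R]_q) (ys : 'rV[R]_p),
    [/\ saddle_points D (xs, ys),
        it_x S n @[n --> \oo] --> xs &
        it_y S n @[n --> \oo] --> ys].
Proof.
have [xs [ys cl]] := joint_cluster_point D hD P hP S hS.
have [xc yc] := cluster_limit D hD P hP S hS xs ys cl.
by exists xs, ys; split=> //; exact: (cluster_saddle D hD P hP S hS xs ys cl).
Qed.
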